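(* Let $n\ge1$. The set $$\Sigma_2=\{\,t_{i_1}^{k_1}t_{i_2}^{k_2}\cdots t_{i_r}^{k_r}\cdot\sigma\,\},$$ where $r\ge 0$, $0\le i_1<\dots<i_r\le n-1$, $k_1,\dots,k_r\in\mathbb Z\setminus\{0\}$ and $\sigma$ is a basic element of $\mathcal H_n(q)$, forms a basis of $\mathcal H_n(q,\infty)$.
   Context: For $n\ge 1$, $B_{1,n}$ is the group with generators $t,\sigma_1,\dots,\sigma_{n-1}$ and relations $\sigma_1t\sigma_1t=t\sigma_1t\sigma_1$; $t\sigma_i=\sigma_it$ for $i>1$; $\sigma_i\sigma_j=\sigma_j\sigma_i$ for $|i-j|>1$; $\sigma_i\sigma_{i+1}\sigma_i=\sigma_{i+1}\sigma_i\sigma_{i+1}$ for $1\le i\le n-2$. The generalized Iwahori-Hecke algebra $\mathcal H_n(q,\infty)$ of type $\mathcal B_n$ is the quotient of the group algebra $\mathbb Z[q^{\pm1}]B_{1,n}$ ($q$ an indeterminate) by the relations $\sigma_i^2=(q-1)\sigma_i+q$ for all $i$; $g_i$ denotes the image of $\sigma_i$ and $t$ the image of $t$. Basis means basis as a $\mathbb Z[q^{\pm1}]$-module. Put $t_0:=t$ and $t_i:=g_i\cdots g_1\,t\,g_1\cdots g_i$ for $1\le i\le n-1$. The basic elements of $\mathcal H_n(q)$ (the Iwahori-Hecke algebra of type $\mathcal A_{n-1}$, generated by $g_1,\dots,g_{n-1}$) are the products $$(g_{i_1}g_{i_1-1}\cdots g_{i_1-r_1})(g_{i_2}g_{i_2-1}\cdots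 g_{i_2-r_2})\cdots(g_{i_p}g_{i_p-1}\cdots g_{i_p-r_p})$$ with $p\ge0$, $1\le i_1<\dots<i_p\le n-1$ and $r_j\in\{0,1,\dots,i_j-1\}$ (the empty product being $1$). *)

(* Defs.v *)
From HB Require Import structures.
From mathcomp Require Import all_boot all_algebra.
From mathcomp Require Import finmap boolp classical_sets.
From mathcomp.multinomials Require Import monalg.

Set Implicit Arguments.
Unset Strict Implicit.
Unset Printing Implicit Defensive.

Import GRing.Theory.
Local Open Scope ring_scope.
Local Open Scope quotient_scope.

Section Presentation.
Variable X : choiceType.

(* The letter (x, false) stands for x and (x, true) for x^-1. *)
Definition word : Type := seq (X * bool).
HB.instance Definition _ := Choice.on word.

Implicit Types u v w : word.

Definition inv_word w : word := rev [seq (p.1, ~~ p.2) | p <- w].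

Variable rel : word -> word -> Prop.

Inductive pres_eq : word -> word -> Prop :=
| pres_refl w : pres_eq w w
| pres_sym u v : pres_eq u v -> pres_eq v u
| pres_trans u v w : pres_eq u v -> pres_eq v w -> pres_eq u w
| pres_cancel u x b v : pres_eq (u ++ [:: (x, b), (x, ~~ b) & v]) (u ++ v)
| pres_rel u l r v : rel l r -> pres_eq (u ++ l ++ v) (u ++ r ++ v).

Definition pres_eqb u v : bool := `[< pres_eq u v >].

Fact pres_eqb_equiv : equiv_class_of pres_eqb.
Proof.
split=> [u|u v|v u w].
- exact/asboolP/pres_refl.
- by apply/asboolP/asboolP; apply: pres_sym.
- by move=> /asboolP uv /asboolP vw; apply/asboolP; apply: pres_trans uv vw.
Qed.

Canonical pres_eqb_rel := EquivRelPack pres_eqb_equiv.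
Canonical pres_eqb_enc := defaultEncModRel pres_eqb.

Definition pres_group : Type := {eq_quot pres_eqb}.
HB.instance Definition _ := Choice.on pres_group.
HB.instance Definition _ : EqQuotient word pres_eqb pres_group :=
  EqQuotient.on pres_group.

Definition pres_class w : pres_group := \pi_pres_group w.

Lemma pres_classP u v : pres_class u = pres_class v <-> pres_eq u v.
Proof. by split=> [/eqquotP/asboolP|uv]; last exact/eqquotP/asboolP. Qed.

Lemma pres_repr u : pres_eq (repr (pres_class u)) u.
Proof. by apply/pres_classP; rewrite /pres_class reprK. Qed.

Lemma pres_class_repr (x : pres_group) : pres_class (repr x) = x.
Proof. by rewrite /pres_class reprK. Qed.

Lemma pres_cat2 u v w w' : pres_eq w w' -> pres_eq (u ++ w ++ v) (u ++ w' ++ v).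
Proof.
elim=> {w w'} [w|w w' _|w w' w'' _ h1 _ h2|w x b w'|w l r w' lr].
- exact: pres_refl.
- exact: pres_sym.
- exact: pres_trans h1 h2.
- by rewrite -!catA !(catA u); apply: pres_cancel.
- by rewrite -!catA !(catA u); apply: pres_rel.
Qed.

Lemma pres_cat u u' v v' :
  pres_eq u u' -> pres_eq v v' -> pres_eq (u ++ v) (u' ++ v').
Proof.
move=> uu' vv'; apply: (@pres_trans _ (u' ++ v)).
  exact: (@pres_cat2 [::] v).
by have := @pres_cat2 u' [::] _ _ vv'; rewrite !cats0.
Qed.

Lemma inv_word_cat u v : inv_word (u ++ v) = inv_word v ++ inv_word u.
Proof. by rewrite /inv_word map_cat rev_cat. Qed.

Lemma inv_wordK : involutive inv_word.
Proof.
move=> w; rewrite /inv_word map_rev revK -map_comp map_id_in //.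
by move=> [x b] _ /=; rewrite negbK.
Qed.

Lemma pres_mulV w : pres_eq (w ++ inv_word w) [::].
Proof.
elim/last_ind: w => [|w [x b] ih]; first exact: pres_refl.
rewrite -cats1 inv_word_cat -catA /=.
exact: pres_trans (pres_cancel _ _ _ _) ih.
Qed.

Lemma pres_Vmul w : pres_eq (inv_word w ++ w) [::].
Proof. by rewrite -{2}[w]inv_wordK; apply: pres_mulV. Qed.

Lemma pres_inv u v : pres_eq u v -> pres_eq (inv_word u) (inv_word v).
Proof.
move=> uv; apply: (@pres_trans _ (inv_word u ++ (v ++ inv_word v))).
  rewrite -{1}[inv_word u]cats0; apply: pres_cat; first exact: pres_refl.
  exact/pres_sym/pres_mulV.
rewrite catA -{2}[inv_word v]cat0s; apply: pres_cat; last exact: pres_refl.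
apply: pres_trans (pres_Vmul u); apply: pres_cat; first exact: pres_refl.
exact: pres_sym.
Qed.

Definition pres_one := pres_class [::].
Definition pres_mul (x y : pres_group) := pres_class (repr x ++ repr y).
Definition pres_invg (x : pres_group) := pres_class (inv_word (repr x)).

Fact pres_mulA : associative pres_mul.
Proof.
move=> x y z; apply/pres_classP; set a := repr x; set c := repr z.
apply: (@pres_trans _ (a ++ repr y ++ c)).
  exact: pres_cat (pres_refl _) (pres_repr _).
by rewrite catA; apply: pres_cat (pres_sym (pres_repr _)) (pres_refl _).
Qed.

Fact pres_mul1 : left_id pres_one pres_mul.
Proof.
move=> x; rewrite -[RHS]pres_class_repr; apply/pres_classP.
exact: pres_cat (pres_repr [::]) (pres_refl _).
Qed.

Fact pres_mulr1 : right_id pres_one pres_mul.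
Proof.
move=> x; rewrite -[RHS]pres_class_repr; apply/pres_classP.
rewrite -[X in pres_eq _ X]cats0.
exact: pres_cat (pres_refl _) (pres_repr [::]).
Qed.

Fact pres_mulVx : left_inverse pres_one pres_invg pres_mul.
Proof.
move=> x; apply/pres_classP; apply: pres_trans (pres_Vmul (repr x)).
exact: pres_cat (pres_repr _) (pres_refl _).
Qed.

Fact pres_mulxV : right_inverse pres_one pres_invg pres_mul.
Proof.
move=> x; apply/pres_classP; apply: pres_trans (pres_mulV (repr x)).
exact: pres_cat (pres_refl _) (pres_repr _).
Qed.

HB.instance Definition _ := isGroup.Build pres_group
  pres_mulA pres_mul1 pres_mulr1 pres_mulVx pres_mulxV.

Lemma pres_class_cat u v :
  pres_class (u ++ v) = (pres_class u * pres_class v)%g.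
Proof.
apply/esym/pres_classP; exact: pres_cat (pres_repr _) (pres_repr _).
Qed.

End Presentation.

(* The monoid algebra of multinomials only covers monoids without nontrivial
   units, so only its underlying module of finitely supported functions is
   reused; << c *g x >> is the element c x. *)
Definition group_algebra (R : comNzRingType) (G : groupType) : Type :=
  {malg R[G]}.

Section GroupAlgebra.
Variables (R : comNzRingType) (G : groupType).
Local Notation RG := (group_algebra R G).

HB.instance Definition _ := GRing.Lmodule.copy RG {malg R[G]}.

Implicit Types f g h : RG.

Definition ga_mul f g : RG :=
  \sum_(x <- msupp f) \sum_(y <- msupp g) << f@_x * g@_y *g (x * y)%g >>.

Lemma ga_mulw (d e : {fset G}) f g :
  (msupp f `<=` d)%fset -> (msupp g `<=` e)%fset ->
  ga_mul f g = \sum_(x <- d) \sum_(y <- e) << f@_x * g@_y *g (x * y)%g >>.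
Proof.
move=> fd ge; rewrite /ga_mul (big_fset_incl _ fd) /=.
  apply/eq_bigr=> x _; apply/big_fset_incl => // y _ /mcoeff_outdom ->.
  by rewrite mulr0 monalgU0.
move=> x _ /mcoeff_outdom fx.
by rewrite big1 // => y _; rewrite fx mul0r monalgU0.
Qed.

Lemma ga_mulDl : left_distributive ga_mul +%R.
Proof.
move=> f1 f2 g; have sub := fsubset_refl (msupp g).
rewrite (ga_mulw (msuppD_le f1 f2) sub) (ga_mulw (fsubsetUl _ (msupp f2)) sub).
rewrite (ga_mulw (fsubsetUr (msupp f1) _) sub) -big_split /=.
apply/eq_bigr=> x _; rewrite -big_split /=; apply/eq_bigr=> y _.
by rewrite mcoeffD mulrDl monalgUD.
Qed.

Lemma ga_mulDr : right_distributive ga_mul +%R.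
Proof.
move=> g f1 f2; have sub := fsubset_refl (msupp g).
rewrite (ga_mulw sub (msuppD_le f1 f2)) (ga_mulw sub (fsubsetUl _ (msupp f2))).
rewrite (ga_mulw sub (fsubsetUr (msupp f1) _)) -big_split /=.
apply/eq_bigr=> x _; rewrite -big_split /=; apply/eq_bigr=> y _.
by rewrite mcoeffD mulrDr monalgUD.
Qed.

Lemma ga_mul0 : left_zero 0 ga_mul.
Proof. by move=> g; rewrite /ga_mul msupp0 big_seq_fset0. Qed.

Lemma ga_mulr0 : right_zero 0 ga_mul.
Proof.
by move=> g; rewrite /ga_mul msupp0; apply: big1 => x _; rewrite big_seq_fset0.
Qed.

Lemma ga_mulUU a b x y :
  ga_mul << a *g x >> << b *g y >> = << a * b *g (x * y)%g >>.
Proof. by rewrite (ga_mulw msuppU_le msuppU_le) !big_seq_fset1 !mcoeffUU. Qed.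

Lemma ga_ind (P : RG -> Prop) :
  P 0 -> (forall f g, P f -> P g -> P (f + g)) ->
  (forall a x, P << a *g x >>) -> forall f, P f.
Proof.
move=> P0 PD PU f; rewrite [f]monalgE.
by elim/big_ind: _ => //= x _; apply: PU.
Qed.

Fact ga_mulA : associative ga_mul.
Proof.
move=> f g h; elim/ga_ind: f => [|f1 f2 e1 e2|a x].
- by rewrite !ga_mul0.
- by rewrite !ga_mulDl e1 e2.
elim/ga_ind: g => [|f1 f2 e1 e2|b y].
- by rewrite !(ga_mul0, ga_mulr0).
- by rewrite !(ga_mulDl, ga_mulDr) e1 e2.
elim/ga_ind: h => [|f1 f2 e1 e2|c z].
- by rewrite !ga_mulr0.
- by rewrite !ga_mulDr e1 e2.
by rewrite !ga_mulUU mulrA mulgA.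
Qed.

Fact ga_mul1 : left_id << 1%g >> ga_mul.
Proof.
elim/ga_ind => [|f1 f2 e1 e2|a x]; first by rewrite ga_mulr0.
  by rewrite ga_mulDr e1 e2.
by rewrite ga_mulUU mul1r mul1g.
Qed.

Fact ga_mulr1 : right_id << 1%g >> ga_mul.
Proof.
elim/ga_ind => [|f1 f2 e1 e2|a x]; first by rewrite ga_mul0.
  by rewrite ga_mulDl e1 e2.
by rewrite ga_mulUU mulr1 mulg1.
Qed.

Fact ga_one_neq0 : << 1%g >> != 0 :> RG.
Proof. by rewrite monalgU_eq0 oner_eq0. Qed.

HB.instance Definition _ := GRing.Zmodule_isNzRing.Build RG
  ga_mulA ga_mul1 ga_mulr1 ga_mulDl ga_mulDr ga_one_neq0.

Lemma ga_ME f g : f * g = ga_mul f g. Proof. by []. Qed.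

Lemma ga_scaleU a b x : a *: (<< b *g x >> : RG) = << a * b *g x >>.
Proof. by apply/malgP => y; rewrite mcoeffZ !mcoeffU mulrnAr. Qed.

Fact ga_scaleAl (a : R) f g : a *: (f * g) = (a *: f) * g.
Proof.
elim/ga_ind: f => [|f1 f2 e1 e2|b x].
- by rewrite mul0r scaler0 mul0r.
- by rewrite mulrDl !scalerDr mulrDl e1 e2.
elim/ga_ind: g => [|f1 f2 e1 e2|c y].
- by rewrite !mulr0 scaler0.
- by rewrite !mulrDr scalerDr e1 e2.
by rewrite ga_scaleU !ga_ME !ga_mulUU ga_scaleU mulrA.
Qed.

HB.instance Definition _ := GRing.Lmodule_isLalgebra.Build R RG ga_scaleAl.

Fact ga_scaleAr (a : R) f g : a *: (f * g) = f * (a *: g).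
Proof.
elim/ga_ind: f => [|f1 f2 e1 e2|b x].
- by rewrite !mul0r scaler0.
- by rewrite !mulrDl !scalerDr e1 e2.
elim/ga_ind: g => [|f1 f2 e1 e2|c y].
- by rewrite mulr0 scaler0 mulr0.
- by rewrite mulrDr !scalerDr mulrDr e1 e2.
by rewrite ga_scaleU !ga_ME !ga_mulUU ga_scaleU mulrCA.
Qed.

HB.instance Definition _ := GRing.Lalgebra_isAlgebra.Build R RG ga_scaleAr.

End GroupAlgebra.

Inductive ideal_gen (A : pzRingType) (S : set A) : A -> Prop :=
| ideal_gen0 : ideal_gen S 0
| ideal_gen_base x : S x -> ideal_gen S x
| ideal_genD x y : ideal_gen S x -> ideal_gen S y -> ideal_gen S (x + y)
| ideal_genMl a x : ideal_gen S x -> ideal_gen S (a * x)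
| ideal_genMr a x : ideal_gen S x -> ideal_gen S (x * a).

Definition ideal_pred (A : pzRingType) (S : set A) : pred A :=
  fun x => `[< ideal_gen S x >].

Section IdealZmod.
Variables (A : pzRingType) (S : set A).

Fact ideal_pred_zmod : zmod_closed (ideal_pred S).
Proof.
split=> [|x y /asboolP Sx /asboolP Sy]; apply/asboolP; first exact: ideal_gen0.
by apply: ideal_genD => //; rewrite -mulN1r; apply: ideal_genMl.
Qed.

HB.instance Definition _ :=
  GRing.isZmodClosed.Build A (ideal_pred S) ideal_pred_zmod.

Definition ideal_closed : zmodClosed A :=
  GRing.ZmodClosed.clone A (ideal_pred S) _.
End IdealZmod.

Definition quotient_algebra (R : pzRingType) (A : algType R) (S : set A) : Type :=
  {ideal_quot (ideal_closed S)}.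

Section QuotientAlgebra.
Variables (R : pzRingType) (A : algType R) (S : set A).
Local Notation Q := (quotient_algebra S).

HB.instance Definition _ := GRing.Zmodule.on Q.

Definition quotient_class (x : A) : Q :=
  \pi_{ideal_quot (ideal_closed S)} x.
Local Notation cl := quotient_class.

Lemma quotient_classP x y : cl x = cl y <-> ideal_gen S (x - y).
Proof.
split=> [/eqP|xy]; first by rewrite -Quotient.idealrBE => /asboolP.
by apply/eqP; rewrite -Quotient.idealrBE; apply/asboolP.
Qed.

Lemma quotient_repr x : ideal_gen S (repr (cl x) - x).
Proof. by apply/quotient_classP; rewrite /cl reprK. Qed.

Lemma quotient_class_repr (x : Q) : cl (repr x) = x.
Proof. by rewrite /cl reprK. Qed.

Lemma quotient_classD x y : cl (x + y) = cl x + cl y.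
Proof. exact: Quotient.pi_add. Qed.

Lemma quotient_class0 : cl 0 = 0.
Proof. by apply: (addrI (cl 0)); rewrite -quotient_classD !addr0. Qed.

Definition quotient_mul (x y : Q) : Q := cl (repr x * repr y).
Definition quotient_scale (a : R) (x : Q) : Q := cl (a *: repr x).

Lemma quotient_classM_def x y : cl (x * y) = quotient_mul (cl x) (cl y).
Proof.
apply/esym/quotient_classP; set x' := repr _; set y' := repr _.
have -> : x' * y' - x * y = x' * (y' - y) + (x' - x) * y.
  by rewrite mulrBr mulrBl addrA subrK.
apply: ideal_genD; [apply: ideal_genMl|apply: ideal_genMr];
  exact: quotient_repr.
Qed.

Lemma quotient_classZ_def a x : cl (a *: x) = quotient_scale a (cl x).
Proof.
apply/esym/quotient_classP; rewrite -scalerBr -[_ - _]mul1r scalerAl.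
exact/ideal_genMl/quotient_repr.
Qed.

Lemma quotient_ind (P : Q -> Prop) : (forall x, P (cl x)) -> forall x, P x.
Proof. by move=> Pcl x; rewrite -[x]quotient_class_repr. Qed.

Let clE := (quotient_classM_def, quotient_classD).

Fact quotient_mulA : associative quotient_mul.
Proof.
by do 3!elim/quotient_ind => ?; rewrite -!clE mulrA.
Qed.
Fact quotient_mul1 : left_id (cl 1) quotient_mul.
Proof. by elim/quotient_ind => x; rewrite -clE mul1r. Qed.
Fact quotient_mulr1 : right_id (cl 1) quotient_mul.
Proof. by elim/quotient_ind => x; rewrite -clE mulr1. Qed.
Fact quotient_mulDl : left_distributive quotient_mul +%R.
Proof. by do 3!elim/quotient_ind => ?; rewrite -!clE mulrDl. Qed.
Fact quotient_mulDr : right_distributive quotient_mul +%R.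
Proof. by do 3!elim/quotient_ind => ?; rewrite -!clE mulrDr. Qed.

HB.instance Definition _ := GRing.Zmodule_isPzRing.Build Q
  quotient_mulA quotient_mul1 quotient_mulr1 quotient_mulDl quotient_mulDr.

Fact quotient_scaleA a b x :
  quotient_scale a (quotient_scale b x) = quotient_scale (a * b) x.
Proof. by elim/quotient_ind: x => x; rewrite -!quotient_classZ_def scalerA. Qed.
Fact quotient_scale1 : left_id 1 quotient_scale.
Proof. by elim/quotient_ind=> x; rewrite -quotient_classZ_def scale1r. Qed.
Fact quotient_scaleDr : right_distributive quotient_scale +%R.
Proof.
move=> a; do 2!elim/quotient_ind => ?.
by rewrite -quotient_classD -!quotient_classZ_def scalerDr quotient_classD.
Qed.
Fact quotient_scaleDl x : {morph quotient_scale^~ x : a b / a + b}.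
Proof.
by move=> a b; elim/quotient_ind: x => x;
   rewrite -!quotient_classZ_def scalerDl quotient_classD.
Qed.

HB.instance Definition _ := GRing.Zmodule_isLmodule.Build R Q
  quotient_scaleA quotient_scale1 quotient_scaleDr quotient_scaleDl.

Lemma quotient_class1 : cl 1 = 1. Proof. by []. Qed.

Lemma quotient_classM x y : cl (x * y) = cl x * cl y.
Proof. exact: quotient_classM_def. Qed.

Lemma quotient_classZ a x : cl (a *: x) = a *: cl x.
Proof. exact: quotient_classZ_def. Qed.

Lemma quotient_scaleAl (a : R) (x y : Q) : a *: (x * y) = (a *: x) * y.
Proof.
elim/quotient_ind: x => x; elim/quotient_ind: y => y.
by rewrite -!(quotient_classM, quotient_classZ) scalerAl.
Qed.

Lemma quotient_scaleAr (a : R) (x y : Q) : a *: (x * y) = x * (a *: y).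
Proof.
elim/quotient_ind: x => x; elim/quotient_ind: y => y.
by rewrite -!(quotient_classM, quotient_classZ) scalerAr.
Qed.

End QuotientAlgebra.

Definition laurent_pred : pred {fraction {poly int}} :=
  fun x => `[< exists (p : {poly int}) (k : nat),
                x = tofrac p / tofrac 'X ^+ k >].

Fact tofracX_neq0 k : tofrac ('X : {poly int}) ^+ k != 0.
Proof. by rewrite expf_neq0 // tofrac_eq0 polyX_eq0. Qed.

Fact laurent_subring : subring_closed laurent_pred.
Proof.
split=> [|x y|x y].
- by apply/asboolP; exists 1, 0; rewrite expr0 divr1 tofrac1.
- move=> /asboolP[p [k ->]] /asboolP[p' [k' ->]]; apply/asboolP.
  exists (p * 'X ^+ k' - p' * 'X ^+ k), (k + k')%N.
  rewrite tofracB !tofracM !tofracXn mulrBl; congr (_ - _).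
    by rewrite exprD -mulf_div divff ?tofracX_neq0 // mulr1.
  by rewrite addnC exprD -mulf_div divff ?tofracX_neq0 // mulr1.
- move=> /asboolP[p [k ->]] /asboolP[p' [k' ->]]; apply/asboolP.
  by exists (p * p'), (k + k')%N; rewrite mulf_div -exprD -tofracM.
Qed.

HB.instance Definition _ :=
  GRing.isSubringClosed.Build _ laurent_pred laurent_subring.

Record laurent : Type := Laurent {
  laurent_val : {fraction {poly int}};
  laurent_valP : laurent_val \in laurent_pred }.

HB.instance Definition _ := [isSub for laurent_val].
HB.instance Definition _ := [Choice of laurent by <:].
HB.instance Definition _ := [SubChoice_isSubComNzRing of laurent by <:].

Fact laurent_qP : tofrac 'X \in laurent_pred.
Proof. by apply/asboolP; exists 'X, 0; rewrite expr0 divr1. Qed.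

Definition laurent_q : laurent := Laurent laurent_qP.
Local Notation q := laurent_q.

Section BraidGroup.
Variable n : nat.

(* When n >= 1 this is 'I_n: 0 is the generator t, and i such that 1 <= i < n
   is the generator sigma_i. *)
Definition braidB_gen : choiceType := 'I_n.-1.+1.

(* Only meant for i < n: inord sends the other indices to 0. *)
Definition letter (i : nat) : braidB_gen * bool := (inord i, false).
Local Notation t := (letter 0).
Local Notation s := letter.

Inductive braidB_rel : word braidB_gen -> word braidB_gen -> Prop :=
| braidB_t1 : (1 < n)%N -> braidB_rel [:: s 1; t; s 1; t] [:: t; s 1; t; s 1]
| braidB_t i : (1 < i < n)%N -> braidB_rel [:: t; s i] [:: s i; t]
| braidB_far i j : (0 < i < n)%N -> (0 < j < n)%N ->
    (i.+1 < j)%N || (j.+1 < i)%N -> braidB_rel [:: s i; s j] [:: s j; s i]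
| braidB_braid i : (0 < i)%N -> (i.+1 < n)%N ->
    braidB_rel [:: s i; s i.+1; s i] [:: s i.+1; s i; s i.+1].

Definition braidB : groupType := pres_group braidB_rel.

Definition braidB_letter (i : nat) : braidB := pres_class braidB_rel [:: s i].

End BraidGroup.

Section Hecke.
Variable n : nat.

Local Notation ZB := (group_algebra laurent (braidB n)).
Local Notation sigma i := (<< braidB_letter n i >> : ZB).

Definition hecke_rel : set ZB :=
  [set x | exists2 i : nat, (0 < i < n)%N
                  & x = sigma i ^+ 2 - ((q - 1) *: sigma i + q%:A)].

Definition hecke : Type := quotient_algebra hecke_rel.

HB.instance Definition _ := GRing.PzRing.on hecke.
HB.instance Definition _ := GRing.Lmodule.on hecke.

(* The ring is not trivial: t |-> 1, sigma_i |-> -1 defines a character. *)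
Definition nb_sigma (w : word (braidB_gen n)) := count (fun p => p.1 != ord0) w.

Lemma nb_sigma_eq u v :
  pres_eq (@braidB_rel n) u v -> odd (nb_sigma u) = odd (nb_sigma v).
Proof.
have nz i : (0 < i < n)%N -> inord i != ord0 :> 'I_n.-1.+1.
  by move=> /andP[i0 lin]; rewrite -val_eqE /= inordK ?gtn_eqF // (ltn_predK lin).
elim=> {u v} [w|u v _ ->|u v w _ -> _ ->|u x b v|u l r v lr] //.
  by rewrite /nb_sigma !count_cat /= !oddD addKb.
rewrite /nb_sigma !count_cat !oddD; congr (_ (+) (_ (+) _)).
case: lr => [_|i _|i j _ _ _|i i0 lin] /=; rewrite ?addn0.
- by rewrite addnC -!addnA.
- by rewrite addnC.
- by rewrite addnC.
by rewrite !nz // ?i0 //= (ltn_trans _ lin).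
Qed.

Definition hecke_chi (x : braidB n) : laurent := (-1) ^+ nb_sigma (repr x).

Lemma hecke_chi_class w :
  hecke_chi (pres_class (@braidB_rel n) w) = (-1) ^+ nb_sigma w.
Proof.
by rewrite /hecke_chi -signr_odd (nb_sigma_eq (pres_repr _ w)) signr_odd.
Qed.

Lemma hecke_chiM x y : hecke_chi (x * y)%g = hecke_chi x * hecke_chi y.
Proof. by rewrite hecke_chi_class /nb_sigma count_cat exprD. Qed.

Definition hecke_aug (f : ZB) : laurent :=
  \sum_(x <- msupp f) f@_x * hecke_chi x.

Lemma hecke_augw (d : {fset braidB n}) f :
  (msupp f `<=` d)%fset -> hecke_aug f = \sum_(x <- d) f@_x * hecke_chi x.
Proof.
move=> fd; rewrite /hecke_aug (big_fset_incl _ fd) //= => x _ /mcoeff_outdom ->.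
by rewrite mul0r.
Qed.

Lemma hecke_augD f g : hecke_aug (f + g) = hecke_aug f + hecke_aug g.
Proof.
rewrite (hecke_augw (msuppD_le f g)) (hecke_augw (fsubsetUl _ (msupp g))).
rewrite (hecke_augw (fsubsetUr (msupp f) _)) -big_split /=.
by apply: eq_bigr => x _; rewrite mcoeffD mulrDl.
Qed.

Lemma hecke_augU c x : hecke_aug << c *g x >> = c * hecke_chi x.
Proof. by rewrite (hecke_augw msuppU_le) big_seq_fset1 mcoeffUU. Qed.

Lemma hecke_aug0 : hecke_aug 0 = 0.
Proof. by rewrite /hecke_aug msupp0 big_seq_fset0. Qed.

Lemma hecke_augM f g : hecke_aug (f * g) = hecke_aug f * hecke_aug g.
Proof.
elim/ga_ind: f => [|f1 f2 e1 e2|b x].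
- by rewrite mul0r hecke_aug0 mul0r.
- by rewrite mulrDl !hecke_augD mulrDl e1 e2.
elim/ga_ind: g => [|f1 f2 e1 e2|c y].
- by rewrite mulr0 hecke_aug0 mulr0.
- by rewrite mulrDr !hecke_augD mulrDr e1 e2.
by rewrite ga_ME ga_mulUU !hecke_augU hecke_chiM mulrACA.
Qed.

Lemma hecke_aug1 : hecke_aug 1 = 1.
Proof. by rewrite hecke_augU mul1r hecke_chi_class expr0. Qed.

Lemma hecke_aug_ideal x : ideal_gen hecke_rel x -> hecke_aug x = 0.
Proof.
elim=> {x} [|_ [i /andP[i0 lin] ->]|x y _ ex _ ey|a x _ ex|a x _ ex].
- exact: hecke_aug0.
- have -> : - ((q - 1) *: sigma i + q%:A) =
            << - (q - 1) *g braidB_letter n i >> + << - q *g 1%g >> :> ZB.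
    by rewrite opprD !monalgUN !ga_scaleU !mulr1.
  rewrite !hecke_augD expr2 hecke_augM !hecke_augU !hecke_chi_class /nb_sigma /=.
  rewrite -val_eqE /= inordK ?(ltn_predK lin) //.
  rewrite gtn_eqF // addn0 expr0 expr1 !mul1r mulrN1 opprK mulrNN mulr1.
  by rewrite mulr1 addrAC subrr add0r subrr.
- by rewrite hecke_augD ex ey addr0.
- by rewrite hecke_augM ex mulr0.
- by rewrite hecke_augM ex mul0r.
Qed.

Fact hecke_oner_neq0 : (1 : hecke) != 0.
Proof.
apply/eqP => e; have /hecke_aug_ideal : ideal_gen hecke_rel (1 - 0).
  by apply/quotient_classP; rewrite quotient_class0; exact: e.
by rewrite subr0 hecke_aug1 => /eqP; rewrite oner_eq0.
Qed.

HB.instance Definition _ :=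
  GRing.PzSemiRing_isNonZero.Build hecke hecke_oner_neq0.
HB.instance Definition _ := GRing.Lmodule_isLalgebra.Build laurent hecke
  (@quotient_scaleAl _ _ hecke_rel).
HB.instance Definition _ := GRing.Lalgebra_isAlgebra.Build laurent hecke
  (@quotient_scaleAr _ _ hecke_rel).

(* The library's x ^ k for k : int needs a unitRingType. It is the genuine
   power on invertible elements, hence on the t_i (hecke_ti_unit). *)
Definition hecke_has_inv (x : hecke) := exists y, y * x = 1 /\ x * y = 1.
Definition hecke_unit : pred hecke := fun x => `[< hecke_has_inv x >].
Definition hecke_inv (x : hecke) : hecke :=
  if pselect (hecke_has_inv x) is left h then sval (cid h) else x.

Fact hecke_mulVr : {in hecke_unit, left_inverse 1 hecke_inv *%R}.
Proof.
move=> x /asboolP h; rewrite /hecke_inv; case: pselect => // {}h.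
by have [] := svalP (cid h).
Qed.
Fact hecke_divrr : {in hecke_unit, right_inverse 1 hecke_inv *%R}.
Proof.
move=> x /asboolP h; rewrite /hecke_inv; case: pselect => // {}h.
by have [] := svalP (cid h).
Qed.
Fact hecke_unitrP x y : y * x = 1 /\ x * y = 1 -> hecke_unit x.
Proof. by move=> xy; apply/asboolP; exists y. Qed.
Fact hecke_invr_out : {in [predC hecke_unit], hecke_inv =1 id}.
Proof.
by move=> x /asboolP h; rewrite /hecke_inv; case: pselect.
Qed.

HB.instance Definition _ := GRing.NzRing_hasMulInverse.Build hecke
  hecke_mulVr hecke_divrr hecke_unitrP hecke_invr_out.

Definition hecke_class (x : braidB n) : hecke :=
  quotient_class hecke_rel << x >>.

Definition hecke_t : hecke := hecke_class (braidB_letter n 0).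
Definition hecke_g (i : nat) : hecke := hecke_class (braidB_letter n i).
Local Notation t := hecke_t.
Local Notation g := hecke_g.

Definition hecke_ti (i : nat) : hecke :=
  (\prod_(0 <= j < i) g (i - j)) * t * \prod_(1 <= j < i.+1) g j.

Lemma hecke_class_unit x : hecke_class x \is a GRing.unit.
Proof.
apply/unitrP; exists (hecke_class x^-1%g).
by rewrite /hecke_class -!quotient_classM !ga_ME !ga_mulUU mulr1 mulVg mulgV.
Qed.

Lemma hecke_ti_unit i : hecke_ti i \is a GRing.unit.
Proof.
by rewrite /hecke_ti !rpredM ?rpred_prod // => *; apply: hecke_class_unit.
Qed.

Definition hecke_run (i r : nat) : hecke := \prod_(0 <= j < r.+1) g (i - j).

(* b lists the pairs (i_1, r_1), ..., (i_p, r_p); the basic elements of the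
   subalgebra of type A_(n-1) are taken directly in the algebra of type B_n. *)
Definition hecke_basic : set hecke :=
  [set x | exists b : seq (nat * nat),
    [/\ sorted ltn [seq p.1 | p <- b],
        (forall i r, (i, r) \in b -> (1 <= i <= n.-1)%N /\ (r <= i.-1)%N)
      & x = \prod_(p <- b) hecke_run p.1 p.2]].

(* e lists the pairs (i_1, k_1), ..., (i_r, k_r). *)
Definition Sigma2 : set hecke :=
  [set x | exists (e : seq (nat * int)) (sigma : hecke),
    [/\ sorted ltn [seq p.1 | p <- e],
        (forall i k, (i, k) \in e -> (i <= n.-1)%N /\ k != 0),
        hecke_basic sigma
      & x = (\prod_(p <- e) hecke_ti p.1 ^ p.2) * sigma]].

End Hecke.

Definition linear_independent (R : nzRingType) (M : lmodType R) (S : set M) :=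
  forall (s : seq M) (c : M -> R), uniq s -> (forall x, x \in s -> S x) ->
    \sum_(x <- s) c x *: x = 0 -> forall x, x \in s -> c x = 0.

Definition generating (R : nzRingType) (M : lmodType R) (S : set M) :=
  forall y, exists (s : seq M) (c : M -> R),
    (forall x, x \in s -> S x) /\ y = \sum_(x <- s) c x *: x.

Definition is_basis (R : nzRingType) (M : lmodType R) (S : set M) :=
  linear_independent S /\ generating S.

(* Main.v *)
From HB Require Import structures.
Require Import Defs.
From mathcomp Require Import all_boot all_algebra.
From mathcomp Require Import finmap boolp.
From mathcomp.multinomials Require Import monalg.
From mathcomp Require Import zify ring.
From mathcomp Require Import order perm.

Set Implicit Arguments.
Unset Strict Implicit.
Unset Printing Implicit Defensive.

Import GRing.Theory.
Local Open Scope ring_scope.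

(* Since t_i = g_i t_(i-1) g_i, this is Bernstein's presentation of the affine
   Hecke algebra of GL_n, the t_i being multiples q^i X_i of the generators of
   its lattice part.

   Spanning: the t_i commute, g_j commutes with t_i unless i is j or j-1, and in
   these two cases g_j t_i^(+-1) is a combination of t_(i')^(+-1) and
   t_(i')^(+-1) g_j with i' in {j-1, j}.  So the span of Sigma2 is stable under
   left multiplication by all the generators and their inverses.

   Independence: H acts on the right on the functions from S_n to a field F,
   t multiplying the value at v by x_(v 0) and g_i acting by a Demazure-Lusztig
   operator (the principal series representation).  Then t_i multiplies the
   value at v by q^i x_(v i), and the vectors obtained from the delta function
   at 1 by acting with the basic elements are linearly independent, by a
   triangularity argument on the position of the largest moved point.  A
   relation between elements of Sigma2 thus gives, for each basic element, a
   relation between Laurent monomials in the x_j; taking x_j = z^(N^j) in K(z),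
   N larger than the exponents involved (Kronecker substitution), these
   monomials are independent over K = Q(q). *)

(** * The defining relations, read in the Hecke algebra *)

Lemma nested_prodS (S : pzRingType) (g : nat -> S) (t : S) i :
  (\prod_(0 <= j < i.+1) g (i.+1 - j)%N) * t * \prod_(1 <= j < i.+2) g j =
  g i.+1 * ((\prod_(0 <= j < i) g (i - j)%N) * t * \prod_(1 <= j < i.+1) g j) * g i.+1.
Proof.
rewrite big_nat_recl // big_nat_recr //= subn0 !mulrA.
by under eq_bigr do rewrite subSS.
Qed.

Lemma nested_prod0 (S : pzRingType) (g : nat -> S) (t : S) :
  (\prod_(0 <= j < 0) g (0 - j)%N) * t * \prod_(1 <= j < 1) g j = t.
Proof. by rewrite !big_geq // mul1r mulr1. Qed.

Section Relations.
Variable n : nat.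

Local Notation H := (hecke n.+1).
Local Notation g := (@hecke_g n.+1).
Local Notation t := (hecke_t n.+1).
Local Notation ti := (@hecke_ti n.+1).
Local Notation q := laurent_q.

Lemma hecke_classM x y : @hecke_class n.+1 (x * y)%g = hecke_class x * hecke_class y.
Proof. by rewrite /hecke_class -quotient_classM ga_ME ga_mulUU mulr1. Qed.

Definition hecke_word (w : word (braidB_gen n.+1)) : H :=
  hecke_class (pres_class (@braidB_rel n.+1) w).

Lemma hecke_word_cat u v : hecke_word (u ++ v) = hecke_word u * hecke_word v.
Proof. by rewrite /hecke_word pres_class_cat hecke_classM. Qed.

Lemma hecke_word_cons l u : hecke_word (l :: u) = hecke_word [:: l] * hecke_word u.
Proof. by rewrite -hecke_word_cat. Qed.

Lemma hecke_word1 i : hecke_word [:: letter n.+1 i] = g i.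
Proof. by []. Qed.

Lemma hecke_word_rel u v : @braidB_rel n.+1 u v -> hecke_word u = hecke_word v.
Proof.
move=> uv; congr hecke_class; apply/pres_classP.
by rewrite -[u]cats0 -[v]cats0; apply: (@pres_rel _ _ [::]).
Qed.

Lemma hecke_g0 : g 0 = t. Proof. by []. Qed.

Lemma hecke_g_sqr i : (0 < i <= n)%N -> g i * g i = (q - 1) *: g i + q%:A.
Proof.
move=> hi; rewrite -[in RHS]quotient_class1 -!quotient_classZ -quotient_classD.
rewrite -quotient_classM -expr2; apply/quotient_classP.
by apply: ideal_gen_base; exists i.
Qed.

Lemma hecke_tgtg : (0 < n)%N -> g 1 * (t * (g 1 * t)) = t * (g 1 * (t * g 1)).
Proof.
move=> n0; have := hecke_word_rel (@braidB_t1 n.+1 n0).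
by rewrite !(hecke_word_cons _ (_ :: _)) !hecke_word1.
Qed.

Lemma hecke_tg i : (1 < i <= n)%N -> GRing.comm t (g i).
Proof.
move=> hi; have := hecke_word_rel (@braidB_t n.+1 i hi).
by rewrite !(hecke_word_cons _ (_ :: _)) !hecke_word1.
Qed.

Lemma hecke_g_far i j : (0 < i <= n)%N -> (0 < j <= n)%N ->
  (i.+1 < j)%N || (j.+1 < i)%N -> GRing.comm (g i) (g j).
Proof.
move=> hi hj hij; have := hecke_word_rel (@braidB_far n.+1 i j hi hj hij).
by rewrite !(hecke_word_cons _ (_ :: _)) !hecke_word1.
Qed.

Lemma hecke_g_braid i : (0 < i < n)%N ->
  g i * (g i.+1 * g i) = g i.+1 * (g i * g i.+1).
Proof.
move=> /andP[i0 hi]; have := hecke_word_rel (@braidB_braid n.+1 i i0 hi).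
by rewrite !(hecke_word_cons _ (_ :: _)) !hecke_word1.
Qed.

Lemma hecke_tiS i : ti i.+1 = g i.+1 * ti i * g i.+1.
Proof. exact: (@nested_prodS H). Qed.

Lemma hecke_ti0 : ti 0 = t.
Proof. exact: (@nested_prod0 H). Qed.

End Relations.

(** * Spanning *)

(** Combinations are built one term at a time, repetitions allowed, so that closure under sums and
    products is a plain induction; [lspan_generating] leads back to [generating]. *)
Inductive lspan (R : nzRingType) (M : lmodType R) (S : M -> Prop) : M -> Prop :=
| lspan0 : lspan S 0
| lspan_step a x y : S x -> lspan S y -> lspan S (a *: x + y).

Section LinearSpan.
Variables (R : nzRingType) (M : lmodType R).
Implicit Types S : M -> Prop.

Lemma lspan_base S x : S x -> lspan S x.
Proof.
move=> Sx; rewrite -[x]scale1r -[X in lspan _ X]addr0.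
by apply: lspan_step => //; apply: lspan0.
Qed.

Lemma lspanD S x y : lspan S x -> lspan S y -> lspan S (x + y).
Proof.
by elim=> {x} [|a x z Sx _ ih] Sy; rewrite ?add0r // -addrA;
  apply: lspan_step => //; apply: ih.
Qed.

Lemma lspanZ S a x : lspan S x -> lspan S (a *: x).
Proof.
elim=> [|b y z Sy _ ih]; first by rewrite scaler0; apply: lspan0.
by rewrite scalerDr scalerA; apply: lspan_step.
Qed.

Lemma lspan_generating S : (forall x, lspan S x) -> @generating R M S.
Proof.
(* Coefficients are a function of the vector, so the list is kept free of repetitions and a repeated
   vector only changes its coefficient. *)
move=> Sx y; suff [s [c [_ Ss ->]]] : exists (s : seq M) (c : M -> R),
    [/\ uniq s, forall x, x \in s -> S x & y = \sum_(x <- s) c x *: x].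
  by exists s, c.
elim: (Sx y) => [|a x z Sxx _ [s [c [us Ss ->]]]].
  by exists [::], (fun=> 0); rewrite big_nil.
(* [c] may be nonzero outside [s], in particular at [x]; hence the cut-off. *)
pose c' z := c z *+ (z \in s) + a *+ (z == x).
have c'E w : c' w *: w = c w *: w *+ (w \in s) + a *: w *+ (w == x).
  by rewrite /c' scalerDl !scalerMnl.
have [xs|xs] := boolP (x \in s).
  exists s, c'; split=> //; rewrite (eq_bigr _ (fun w _ => c'E w)) big_split addrC /=.
  congr (_ + _).
    by rewrite big_seq [RHS]big_seq; apply: eq_bigr => w ->.
  rewrite (bigD1_seq x) //= eqxx big1 ?addr0 // => w /negPf ->.
  by rewrite mulr0n.
exists (x :: s), c'; split; rewrite ?cons_uniq ?xs //.
  by move=> w; rewrite inE => /predU1P[->|/Ss].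
rewrite big_cons c'E (negPf xs) eqxx mulr0n add0r; congr (_ + _).
rewrite big_seq [RHS]big_seq; apply: eq_bigr => w ws; rewrite c'E ws.
by case: eqP ws xs => [->->|] //; rewrite mulr0n addr0.
Qed.

End LinearSpan.

Section SpanAlgebra.
Variables (R : comNzRingType) (A : algType R).
Implicit Types (S : A -> Prop) (a : A).

Lemma lspan_mulr S S' a : (forall x, S x -> lspan S' (x * a)) ->
  forall x, lspan S x -> lspan S' (x * a).
Proof.
move=> SS' x; elim=> {x} [|b x y Sx _ ih]; first by rewrite mul0r; apply: lspan0.
by rewrite mulrDl -scalerAl; apply: lspanD => //; apply/lspanZ/SS'.
Qed.

Lemma lspan_mull S S' a : (forall x, S x -> lspan S' (a * x)) ->
  forall x, lspan S x -> lspan S' (a * x).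
Proof.
move=> SS' x; elim=> {x} [|b x y Sx _ ih]; first by rewrite mulr0; apply: lspan0.
by rewrite mulrDr -scalerAr; apply: lspanD => //; apply/lspanZ/SS'.
Qed.

End SpanAlgebra.

(** * Consequences of the relations in an arbitrary algebra *)

Section HeckeRelations.
Variables (R : comNzRingType) (A : unitAlgType R) (n : nat) (q qi : R).
Variables (t : A) (g ti : nat -> A).
Hypothesis qiq : qi * q = 1.
Hypothesis t_unit : t \is a GRing.unit.
Hypothesis g_sqr : forall i, (0 < i <= n)%N -> g i * g i = (q - 1) *: g i + q%:A.
Hypothesis tgtg : (0 < n)%N -> g 1%N * (t * (g 1%N * t)) = t * (g 1%N * (t * g 1%N)).
Hypothesis comm_tg : forall i, (1 < i <= n)%N -> GRing.comm t (g i).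
Hypothesis comm_gg : forall i j, (0 < i <= n)%N -> (0 < j <= n)%N ->
  (i.+1 < j)%N || (j.+1 < i)%N -> GRing.comm (g i) (g j).
Hypothesis g_braid : forall i, (0 < i < n)%N ->
  g i * (g i.+1 * g i) = g i.+1 * (g i * g i.+1).

Hypothesis ti0 : ti 0%N = t.
Hypothesis tiS : forall i, ti i.+1 = g i.+1 * ti i * g i.+1.

Lemma comm_g_ti j i : (0 < j <= n)%N -> (i <= n)%N -> j != i -> j != i.+1 ->
  GRing.comm (g j) (ti i).
Proof.
elim/ltn_ind: i j => -[_ j jn _ j0 j1|i ih j jn lin j1 j2].
  by rewrite ti0; apply/commr_sym/comm_tg; lia.
have [ji|ji] := eqVneq j i; last first.
  have gji : GRing.comm (g j) (g i.+1) by apply: comm_gg; lia.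
  rewrite tiS; apply: commrM => //; apply: commrM => //; apply: ih; lia.
case: i ji ih lin j1 j2 => [|i] ji ih lin _ _; first by lia.
(* With a = g_j, b = g_(j+1) and t_(j+1) = b a T a b, the computation is a b a T a b = b a b T a b =
   b a T b a b = b a T a b a. *)
subst j; rewrite !tiS; set T := ti i; set a := g i.+1; set b := g i.+2.
have ab : a * (b * a) = b * (a * b) by apply: g_braid; lia.
rewrite !mulrA in ab.
have bT : b * T = T * b by apply: ih; lia.
rewrite /GRing.comm !mulrA ab -(mulrA _ b T) bT.
by rewrite -[in RHS](mulrA _ a b) -[RHS](mulrA _ (a * b) a) ab !mulrA.
Qed.

Lemma comm_t_ti i : (i <= n)%N -> GRing.comm t (ti i).
Proof.
elim: i => [|[|i] ih] lin; rewrite ?tiS ?ti0 //.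
  by rewrite /GRing.comm -!mulrA tgtg.
have ti2 : GRing.comm t (g i.+2) by apply: comm_tg; lia.
rewrite -tiS; apply: commrM => //; apply: commrM => //; apply: ih; lia.
Qed.

(** For i < j, t_i is a word in t and g_1, ..., g_i, all of which commute with t_j. *)
Lemma comm_ti i j : (i <= n)%N -> (j <= n)%N -> GRing.comm (ti i) (ti j).
Proof.
wlog: i j / (i < j)%N => [hw|ij] lin ljn.
  case: (ltngtP i j) => [ij|ij|->//]; first exact: hw.
  exact/commr_sym/hw.
apply/commr_sym; elim: i ij lin => [|i ih] ij lin.
  by rewrite ti0; apply/commr_sym/comm_t_ti.
have c : GRing.comm (ti j) (g i.+1) by apply/commr_sym/comm_g_ti; lia.
by rewrite tiS; apply: commrM => //; apply: commrM => //; apply: ih; lia.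
Qed.

(** * Runs and the spanning set of type A *)

Definition run i l : A := \prod_(0 <= j < l) g (i - j).

Lemma runS i l : run i l.+1 = run i l * g (i - l).
Proof. by rewrite /run big_nat_recr. Qed.

Lemma run0 i : run i 0 = 1.
Proof. by rewrite /run big_geq. Qed.

Lemma comm_run_g i a l : (0 < i)%N -> (i + l < a)%N -> (a <= n)%N ->
  GRing.comm (g i) (run a l).
Proof.
move=> i0 ia an; elim: l ia => [|l ih] ia; first by rewrite run0; apply: commr1.
by rewrite runS; apply: commrM; [apply: ih|apply: comm_gg]; lia.
Qed.

(* [g_a ... g_(a-l+1)] is a Coxeter element of a parabolic subgroup of type A,
   conjugation by which shifts the inner generators. *)
Lemma run_braid a l i : (a.+1 < i + l)%N -> (l <= a)%N -> (i <= a <= n)%N ->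
  run a l * g i = g i.-1 * run a l.
Proof.
elim: l => [|l ih] ail la ian; first by lia.
have [ail'|ail'] := ltnP a.+1 (i + l).
  rewrite runS -mulrA (comm_gg (i := (a - l)%N) (j := i)); try lia.
  by rewrite !mulrA ih //; lia.
case: l ih ail la ail' => [|l] ih ail la ail'; first by lia.
case: i ail ail' ian {ih} => [|i] ail ail' ian /=; first by lia.
rewrite !runS (_ : a - l = i.+1)%N; last by lia.
rewrite (_ : a - l.+1 = i)%N; last by lia.
rewrite -!mulrA -g_braid ?mulrA; last by lia.
by rewrite (comm_run_g (i := i)) //; lia.
Qed.

(* [rho i] is the length of the run starting at [g i], 0 when there is none: it is
   r_j + 1 for i = i_j. *)
Definition gbas m (rho : nat -> nat) : A := \prod_(1 <= i < m.+1) run i (rho i).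

Definition basic m (x : A) :=
  exists2 rho : nat -> nat, (forall i, rho i <= i)%N & x = gbas m rho.

Lemma basicS m l x : (l <= m.+1)%N -> basic m x -> basic m.+1 (x * run m.+1 l).
Proof.
move=> lm [rho hrho ->]; exists (fun i => if i == m.+1 then l else rho i).
  by move=> i; case: eqP => [->|].
rewrite /gbas [RHS]big_nat_recr //= eqxx; congr (_ * _); rewrite !big_nat.
by apply: eq_bigr => i hi; case: eqP => // im; lia.
Qed.

(* The four cases compare [g i] with the last letter [g (m+2-l)] of the last run:
   it commutes past the run, extends it, is absorbed by the quadratic relation, or
   crosses the run with its index lowered. *)
Lemma basic_mulg m i x : (m <= n)%N -> (0 < i <= m)%N -> basic m x ->
  lspan (basic m) (x * g i).
Proof.
elim: m x i => [|m ih] x i mn im [rho hrho ->]; first by lia.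
rewrite /gbas big_nat_recr //= -/(gbas m rho).
have lm := hrho m.+1; move: (rho m.+1) lm => l lm.
have bm : basic m (gbas m rho) by exists rho.
move: (gbas m rho) bm => y bm {rho hrho x}.
have span_run l' z : (l' <= m.+1)%N -> lspan (basic m) z ->
    lspan (basic m.+1) (z * run m.+1 l').
  by move=> hl'; apply: lspan_mulr => w /(basicS hl') /lspan_base.
have [il|il|il] := ltngtP (i + l) m.+1.
- rewrite -mulrA -(comm_run_g (i := i)) ?mulrA //; try lia.
  by apply: span_run => //; apply: ih => //; lia.
- have [il'|il'|il'] := ltngtP (i + l) m.+2; first by lia.
    rewrite -mulrA run_braid ?mulrA //; try lia.
    by apply: span_run => //; apply: ih => //; lia.
  case: l lm il il' => [|l] lm il il'; first by lia.
  have -> : i = (m.+1 - l)%N by lia.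
  rewrite runS -!mulrA g_sqr; last by lia.
  rewrite !mulrDr -!scalerAr mulr1 -runS.
  by apply: lspanD; apply/lspanZ/lspan_base/basicS => //; lia.
- rewrite -mulrA (_ : i = (m.+1 - l)%N); last by lia.
  by rewrite -runS; apply/lspan_base/basicS => //; lia.
Qed.

Definition gword (s : seq nat) : A := \prod_(i <- s) g i.

Lemma basic_gword s : all (fun i => 0 < i <= n)%N s -> lspan (basic n) (gword s).
Proof.
elim/last_ind: s => [|s i ih].
  rewrite /gword big_nil => _; apply: lspan_base; exists (fun=> 0%N) => //.
  by rewrite /gbas big1 // => i _; rewrite run0.
rewrite all_rcons /gword -cats1 big_cat big_seq1 => /andP[hi hs] /=.
by apply: lspan_mulr (ih hs) => x; apply: basic_mulg.
Qed.

Lemma gword_basic m x : (m <= n)%N -> basic m x ->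
  exists2 s, all (fun i => 0 < i <= n)%N s & x = gword s.
Proof.
move=> mn [rho hrho ->].
exists (flatten [seq [seq (i - j)%N | j <- iota 0 (rho i)] | i <- iota 1 m]).
  apply/allP => k /flatten_mapP[i]; rewrite mem_iota => him /mapP[j].
  by rewrite mem_iota => hj ->; have := hrho i; lia.
rewrite /gword big_flatten big_map /gbas /index_iota subn1 /=.
apply: eq_bigr => i _; rewrite big_map /run /index_iota subn0 //.
Qed.

(** Left multiplication reduces to right multiplication: g_i times a basic element is again a word
    in the generators, and [basic_gword] spans all words by appending letters on the right. *)
Lemma mulg_basic i x : (0 < i <= n)%N -> basic n x -> lspan (basic n) (g i * x).
Proof.
move=> hi /(gword_basic (leqnn n))[s hs ->].
have -> : g i * gword s = gword (i :: s) by rewrite /gword big_cons.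
by apply: basic_gword; rewrite /= hi.
Qed.

Lemma g_unit i : (0 < i <= n)%N -> g i \is a GRing.unit.
Proof.
(* The quadratic relation reads g_i (g_i - (q - 1)) = q. *)
move=> hi; apply/unitrP; exists (qi *: (g i - (q - 1)%:A)).
rewrite -scalerAl -scalerAr mulrBl mulrBr g_sqr // -!scalerAl -!scalerAr.
by rewrite mul1r mulr1 addrAC subrr add0r scalerA qiq scale1r.
Qed.

Lemma ti_unit i : (i <= n)%N -> ti i \is a GRing.unit.
Proof.
elim: i => [|i ih] lin; rewrite ?ti0 ?tiS //.
have gu : g i.+1 \is a GRing.unit by apply: g_unit; lia.
by rewrite !rpredM // ih // ltnW.
Qed.

(** * Monomials in the t_i and the Bernstein relations *)

Definition tmon m (lam : nat -> int) : A := \prod_(0 <= i < m) ti i ^ lam i.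

Lemma comm_tiz_tmon i m k lam : (i <= n)%N -> (m <= n.+1)%N ->
  GRing.comm (ti i ^ k) (tmon m lam).
Proof.
move=> hi hm; apply/commr_sym/commrXz/commr_sym.
rewrite /tmon big_nat; apply: commr_prod => j hj.
by apply/commrXz/comm_ti => //; lia.
Qed.

Definition incr_at (lam : nat -> int) i k j := lam j + (if j == i then k else 0).

Lemma mul_ti_tmon i m k lam : (i < m)%N -> (m <= n.+1)%N ->
  ti i ^ k * tmon m lam = tmon m (incr_at lam i k).
Proof.
elim: m => // m ih im mn; rewrite /tmon !big_nat_recr //= -!/(tmon _ _).
have [ltim|leim] := ltnP i m.
  rewrite mulrA ih //; last by lia.
  by rewrite /incr_at gtn_eqF // addr0.
have -> : i = m by lia.
rewrite mulrA comm_tiz_tmon -?mulrA; try lia.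
rewrite -exprzDr ?ti_unit // /incr_at eqxx addrC; congr (_ * _).
rewrite /tmon !big_nat; apply: eq_bigr => j jm; case: eqP => [|_]; first by lia.
by rewrite addr0.
Qed.

(** [Sigma2] with dense data: every t_i gets an exponent and every index a run length, zero standing
    for absence (see [Sigma2P]). *)
Definition bernstein (x : A) := exists lam y, basic n y /\ x = tmon n.+1 lam * y.

Lemma mul_tiz_span i k x : (i <= n)%N -> lspan bernstein x -> lspan bernstein (ti i ^ k * x).
Proof.
move=> hi; apply: lspan_mull => {}x [lam [y [hy ->]]].
apply: lspan_base; exists (incr_at lam i k), y; split=> //.
by rewrite mulrA mul_ti_tmon.
Qed.

(** This lemma and the next four are the Bernstein relations. The quadratic relation is applied to
    t_(j+1) = g_(j+1) t_j g_(j+1) from either side, and the result is solved so that g_(j+1) moves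
    to the right of t_j^(+-1) and t_(j+1)^(+-1). *)
Lemma mul_g_tiSl j : (j < n)%N ->
  g j.+1 * ti j.+1 = (q - 1) *: ti j.+1 + q *: (ti j * g j.+1).
Proof.
move=> jn; rewrite tiS !mulrA g_sqr; last by lia.
by rewrite !mulrDl -!scalerAl mul1r.
Qed.

Lemma mul_g_tiSr j : (j < n)%N ->
  ti j.+1 * g j.+1 = (q - 1) *: ti j.+1 + q *: (g j.+1 * ti j).
Proof.
move=> jn; rewrite tiS -!mulrA g_sqr; last by lia.
by rewrite !mulrDr -!scalerAr mulr1.
Qed.

Lemma mul_g_ti j : (j < n)%N ->
  g j.+1 * ti j = qi *: (ti j.+1 * g j.+1 - (q - 1) *: ti j.+1).
Proof. by move=> jn; rewrite mul_g_tiSr // addrAC subrr add0r scalerA qiq scale1r. Qed.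

Lemma mul_g_tiV j : (j < n)%N ->
  g j.+1 * (ti j)^-1 = (q - 1) *: (ti j)^-1 + q *: ((ti j.+1)^-1 * g j.+1).
Proof.
move=> jn; have uj : ti j \is a GRing.unit by apply: ti_unit; lia.
have ujS : ti j.+1 \is a GRing.unit by apply: ti_unit; lia.
(* Multiplying by t_(j+1) on the left and t_j on the right clears the inverses and leaves
   [mul_g_tiSr]. *)
apply: (mulrI ujS); apply: (mulIr uj); rewrite mulrA (mulrVK uj) mul_g_tiSr //.
rewrite mulrDr mulrDl -!scalerAr -!scalerAl (mulrVK uj); congr (_ + _ *: _).
by rewrite mulrA (divrr ujS) mul1r.
Qed.

Lemma mul_g_tiSV j : (j < n)%N ->
  g j.+1 * (ti j.+1)^-1 = qi *: ((ti j)^-1 * g j.+1 - (q - 1) *: (ti j)^-1).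
Proof.
move=> jn; have uj : ti j \is a GRing.unit by apply: ti_unit; lia.
have ujS : ti j.+1 \is a GRing.unit by apply: ti_unit; lia.
(* Here t_j on the left and t_(j+1) on the right reduce the claim to [mul_g_tiSl]. *)
apply: (mulrI uj); apply: (mulIr ujS); rewrite (mulrA (ti j) (g _)) (mulrVK ujS).
rewrite -scalerAr -scalerAl mulrBr mulrBl (mulrA (ti j) _ (g _)) (divrr uj) mul1r.
rewrite -scalerAr -scalerAl (divrr uj) mul1r mul_g_tiSl //.
by rewrite addrAC subrr add0r scalerA qiq scale1r.
Qed.

(* Stronger than [lspan bernstein x] so as to go through an induction on the
   number of factors t_j^(+-1). *)
Definition g_stable x :=
  lspan bernstein x /\ forall i, (0 < i <= n)%N -> lspan bernstein (g i * x).

Lemma g_stable_basic x : basic n x -> g_stable x.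
Proof.
have basic_span y : lspan (basic n) y -> lspan bernstein y.
  rewrite -{2}[y]mul1r; apply: lspan_mull => {}y hy; apply: lspan_base.
  exists (fun=> 0), y; split=> //; congr (_ * _).
  by rewrite /tmon big1 // => i _; rewrite expr0z.
move=> hx; split=> [|i hi]; first exact/basic_span/lspan_base.
exact/basic_span/mulg_basic.
Qed.

(** Only i = j and i = j + 1 need the Bernstein relations. In all cases the terms obtained are some
    t_k^(+-1) times x or g_i x, which the two halves of [g_stable x] control. *)
Lemma g_stable_ti j x : (j <= n)%N -> g_stable x ->
  g_stable (ti j * x) /\ g_stable ((ti j)^-1 * x).
Proof.
move=> hj [hx hg].
have ht i y : (i <= n)%N -> lspan bernstein y -> lspan bernstein (ti i * y).
  by move=> hi; rewrite -[ti i]expr1z; apply: mul_tiz_span.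
have htV i y : (i <= n)%N -> lspan bernstein y -> lspan bernstein ((ti i)^-1 * y).
  by move=> hi; rewrite -exprN1; apply: mul_tiz_span.
split; split; [exact: ht|move=> i hi|exact: htV|move=> i hi]; rewrite mulrA.
  have [ij|ij] := eqVneq i j.
    case: j ij hj => [|j] ij hj; first by lia.
    rewrite ij mul_g_tiSl // mulrDl -!scalerAl -mulrA -ij.
    by apply: lspanD; apply: lspanZ; apply: ht; rewrite ?ij //; [lia|rewrite -ij; apply: hg].
  have [ij'|ij'] := eqVneq i j.+1; last first.
    by rewrite comm_g_ti // -mulrA; apply: ht => //; apply: hg.
  subst i; rewrite mul_g_ti; last by lia.
  rewrite -scalerAl mulrBl -scalerAl -mulrA -scaleNr.
  by apply/lspanZ/lspanD; [|apply: lspanZ]; apply: ht => //; apply: hg.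
have [ij|ij] := eqVneq i j.
  case: j ij hj => [|j] ij hj; first by lia.
  rewrite ij mul_g_tiSV // -scalerAl mulrBl -scalerAl -mulrA -scaleNr -ij.
  apply/lspanZ/lspanD; [|apply: lspanZ]; apply: htV => //; try lia.
  exact: hg.
have [ij'|ij'] := eqVneq i j.+1; last first.
  rewrite (commrV (comm_g_ti _ _ _ _)) // -mulrA; apply: htV => //; exact: hg.
subst i; rewrite mul_g_tiV; last by lia.
rewrite mulrDl -!scalerAl -mulrA.
by apply: lspanD; apply: lspanZ; apply: htV => //; apply: hg.
Qed.

Lemma g_stable_tiz j k x : (j <= n)%N -> g_stable x -> g_stable (ti j ^ k * x).
Proof.
move=> hj hx; case: k => k.
  rewrite -exprnP; elim: k => [|k ih]; first by rewrite mul1r.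
  by rewrite exprS -mulrA; apply: (g_stable_ti hj ih).1.
rewrite NegzE -exprnN -exprVn; elim: k.+1 => {k} [|k ih]; first by rewrite mul1r.
by rewrite exprS -mulrA; apply: (g_stable_ti hj ih).2.
Qed.

Lemma g_stable_tmon m lam x : (m <= n.+1)%N -> g_stable x -> g_stable (tmon m lam * x).
Proof.
elim: m x => [|m ih] x hm hx; first by rewrite /tmon big_geq // mul1r.
rewrite /tmon big_nat_recr //= -mulrA; apply: ih; first by lia.
exact: g_stable_tiz.
Qed.

Lemma mulg_bernstein i x : (0 < i <= n)%N -> lspan bernstein x -> lspan bernstein (g i * x).
Proof.
move=> hi; apply: lspan_mull => {}x [lam [y [hy ->]]].
by apply: (g_stable_tmon _ _ (g_stable_basic hy)).2.
Qed.

Lemma mulgV_bernstein i x : (0 < i <= n)%N -> lspan bernstein x ->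
  lspan bernstein ((g i)^-1 * x).
Proof.
move=> hi hx; have -> : (g i)^-1 = qi *: (g i - (q - 1)%:A).
  apply: (mulrI (g_unit hi)); rewrite divrr ?g_unit //.
  rewrite -scalerAr mulrBr g_sqr // -!scalerAr mulr1.
  by rewrite addrAC subrr add0r scalerA qiq scale1r.
rewrite -scalerAl mulrBl -scalerAl mul1r -scaleNr.
by apply/lspanZ/lspanD/lspanZ => //; apply: mulg_bernstein.
Qed.

Lemma bernstein1 : bernstein 1.
Proof.
exists (fun=> 0), 1; rewrite mulr1; split.
  by exists (fun=> 0%N) => //; rewrite /gbas big1 // => i _; rewrite run0.
by rewrite /tmon big1 // => i _; rewrite expr0z.
Qed.

End HeckeRelations.

(** * Right modules over the algebra *)

Section RightModule.
Variables (n : nat) (F : fieldType) (phi : {rmorphism laurent -> F}).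
Variables (V : lmodType F) (L : braidB_gen n.+1 * bool -> {linear V -> V}).

Local Notation ZB := (group_algebra laurent (braidB n.+1)).

(** [foldl] applies the first letter first, so this is a right action: h * k acts by h, then by
    k. *)
Definition act_word (v : V) (w : word (braidB_gen n.+1)) : V :=
  foldl (fun u l => L l u) v w.

Hypothesis LK : forall x b v, L (x, ~~ b) (L (x, b) v) = v.
Hypothesis Lrel : forall l r, @braidB_rel n.+1 l r ->
  forall v, act_word v l = act_word v r.
Hypothesis Lquad : forall i, (0 < i <= n)%N -> forall v,
  L (letter n.+1 i) (L (letter n.+1 i) v) =
  (phi laurent_q - 1) *: L (letter n.+1 i) v + phi laurent_q *: v.

Lemma act_word_eq u w : pres_eq (@braidB_rel n.+1) u w ->
  forall v, act_word v u = act_word v w.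
Proof.
elim=> {u w} [w v|u w _ ih v|u v w _ ih _ ih' v0|u x b w v|u l r w lr v] //.
- by rewrite ih ih'.
- by rewrite /act_word !foldl_cat /= LK.
by rewrite /act_word !foldl_cat; congr foldl; apply: Lrel.
Qed.

Lemma act_word_linear w : linear (act_word^~ w).
Proof. by elim: w => [|l w ih] a u v //=; rewrite linearP ih. Qed.

Definition act_group (v : V) (x : braidB n.+1) : V := act_word v (repr x).

Lemma act_group_class v w :
  act_group v (pres_class (@braidB_rel n.+1) w) = act_word v w.
Proof. exact/act_word_eq/pres_repr. Qed.

Lemma act_groupM v x y : act_group v (x * y)%g = act_group (act_group v x) y.
Proof. by rewrite act_group_class /act_word foldl_cat. Qed.

Definition act_ga (v : V) (f : ZB) : V :=
  \sum_(x <- msupp f) phi f@_x *: act_group v x.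

Lemma act_gaw (d : {fset braidB n.+1}) v (f : ZB) : (msupp f `<=` d)%fset ->
  act_ga v f = \sum_(x <- d) phi f@_x *: act_group v x.
Proof.
move=> fd; rewrite /act_ga (big_fset_incl _ fd) //= => x _ /mcoeff_outdom ->.
by rewrite rmorph0 scale0r.
Qed.

Lemma act_gaD v (f g : ZB) : act_ga v (f + g) = act_ga v f + act_ga v g.
Proof.
rewrite (act_gaw v (msuppD_le f g)) (act_gaw v (fsubsetUl _ (msupp g))).
rewrite (act_gaw v (fsubsetUr (msupp f) _)) -big_split /=.
by apply: eq_bigr => x _; rewrite mcoeffD rmorphD scalerDl.
Qed.

Lemma act_ga0 v : act_ga v 0 = 0.
Proof. by rewrite /act_ga msupp0 big_seq_fset0. Qed.

Lemma act_gaU v c x : act_ga v << c *g x >> = phi c *: act_group v x.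
Proof. by rewrite (act_gaw v msuppU_le) big_seq_fset1 mcoeffUU. Qed.

Lemma act_ga_linear f : linear (act_ga^~ f).
Proof.
move=> a u v; rewrite /act_ga scaler_sumr -big_split /=; apply: eq_bigr => x _.
by rewrite /act_group act_word_linear scalerDr !scalerA mulrC.
Qed.

Lemma act_ga_v0 f : act_ga 0 f = 0.
Proof.
by rewrite -[X in act_ga X f](addNr 0) -scaleN1r act_ga_linear scaleN1r addNr.
Qed.

Lemma act_gaM v (f g : ZB) : act_ga v (f * g) = act_ga (act_ga v f) g.
Proof.
elim/ga_ind: f => [|f1 f2 e1 e2|b x].
- by rewrite mul0r act_ga0 act_ga_v0.
- rewrite mulrDl (act_gaD v (f1 * g)) (act_gaD v f1).
  have := act_ga_linear g 1 (act_ga v f1) (act_ga v f2); rewrite !scale1r => ->.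
  by congr (_ + _).
elim/ga_ind: g => [|f1 f2 e1 e2|c y].
- by rewrite !mulr0 !act_ga0.
- by rewrite mulrDr (act_gaD v (_ * f1)) (act_gaD _ f1); congr (_ + _).
rewrite ga_ME ga_mulUU !act_gaU act_groupM rmorphM.
rewrite -[phi b *: _]addr0 [in RHS]/act_group act_word_linear.
rewrite (_ : act_word 0 _ = 0) ?addr0 ?scalerA 1?mulrC //.
by elim: (repr y) => //= l w ih; rewrite linear0.
Qed.

Lemma act_gaN v (f : ZB) : act_ga v (- f) = - act_ga v f.
Proof. by apply: (addrI (act_ga v f)); rewrite -act_gaD !subrr act_ga0. Qed.

Lemma act_ga_quad v (a b : laurent) (x : braidB n.+1) :
  act_ga v ((<< x >> : ZB) ^+ 2 - (a *: (<< x >> : ZB) + b%:A)) =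
  act_group (act_group v x) x - (phi a *: act_group v x + phi b *: v).
Proof.
have -> : b%:A = << b *g 1%g >> :> ZB by rewrite ga_scaleU mulr1.
have sqr (f : ZB) : act_ga v (f ^+ 2) = act_ga (act_ga v f) f by exact: act_gaM.
rewrite ga_scaleU mulr1 (act_gaD v (_ ^+ 2)) act_gaN (act_gaD v << _ *g _ >>).
rewrite sqr; congr (_ - (_ + _)); rewrite act_gaU //.
  by rewrite act_gaU rmorph1 !scale1r.
by rewrite -[1%g]/(pres_class _ [::]) act_group_class.
Qed.

Lemma act_ga_ideal v (f : ZB) : ideal_gen (@hecke_rel n.+1) f -> act_ga v f = 0.
Proof.
move=> hf; elim: hf v => {f} [v|_ [i hi ->] v|f g _ ef _ eg v|f g _ eg v|f g _ eg v].
- exact: act_ga0.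
- by rewrite act_ga_quad !act_group_class /= (rmorphB phi) (rmorph1 phi) Lquad // subrr.
- by rewrite act_gaD ef eg addr0.
- by rewrite act_gaM eg.
- by rewrite act_gaM eg act_ga_v0.
Qed.

Definition act (h : hecke n.+1) (v : V) : V :=
  act_ga v (@repr _ (quotient_algebra (@hecke_rel n.+1)) h).

Lemma act_class v f : act (quotient_class (@hecke_rel n.+1) f) v = act_ga v f.
Proof.
have /(act_ga_ideal v) := quotient_repr (@hecke_rel n.+1) f.
rewrite -scaleN1r (act_gaD v (repr _)) => /eqP.
by rewrite scaleN1r act_gaN subr_eq0 => /eqP.
Qed.

Lemma act_linear h : linear (act h).
Proof. exact: act_ga_linear. Qed.

HB.instance Definition _ h := GRing.isLinear.Build F V V *:%R (act h) (act_linear h).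

Lemma actD v h k : act (h + k) v = act h v + act k v.
Proof.
elim/(@quotient_ind _ _ (@hecke_rel n.+1)): h => f.
elim/(@quotient_ind _ _ (@hecke_rel n.+1)): k => g.
by rewrite -quotient_classD !act_class act_gaD.
Qed.

Lemma actM v h k : act (h * k) v = act k (act h v).
Proof.
elim/(@quotient_ind _ _ (@hecke_rel n.+1)): h => f.
elim/(@quotient_ind _ _ (@hecke_rel n.+1)): k => g.
by rewrite -quotient_classM !act_class act_gaM.
Qed.

Lemma act1 v : act 1 v = v.
Proof. by rewrite -quotient_class1 act_class act_gaU rmorph1 scale1r act_group_class. Qed.

Lemma actZ v a h : act (a *: h) v = phi a *: act h v.
Proof.
elim/(@quotient_ind _ _ (@hecke_rel n.+1)): h => f.
rewrite -quotient_classZ !act_class -[f in LHS]mul1r scalerAl.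
rewrite ga_scaleU mulr1 act_gaM act_gaU act_group_class.
have := act_ga_linear f (phi a) v 0.
by rewrite act_ga_v0 !addr0.
Qed.

Lemma act_sum v (I : Type) (s : seq I) (P : pred I) (h : I -> hecke n.+1) :
  act (\sum_(i <- s | P i) h i) v = \sum_(i <- s | P i) act (h i) v.
Proof.
apply: (big_morph (act^~ v) (actD v)).
by rewrite -quotient_class0 act_class act_ga0.
Qed.

Lemma act_g v i : act (hecke_g n.+1 i) v = L (letter n.+1 i) v.
Proof. by rewrite act_class act_gaU rmorph1 scale1r act_group_class. Qed.

Lemma act_exprz v h (c : F) k : h \is a GRing.unit -> c != 0 ->
  act h v = c *: v -> act (h ^ k) v = c ^ k *: v.
Proof.
move=> hu c0 hv; have hX m : act (h ^+ m) v = c ^+ m *: v.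
  elim: m => [|m ih]; first by rewrite !expr0 act1 scale1r.
  by rewrite exprSr actM ih linearZ /= hv scalerA exprSr.
case: k => k; first exact: hX.
(* Negative exponents: c^(k+1) v is the image of v under h^(k+1), and the inverse of h^(k+1) sends
   it back to v. *)
rewrite NegzE -!exprnN; apply: (scalerI (expf_neq0 k.+1 c0)).
rewrite scalerA divff ?expf_neq0 // scale1r -linearZ -hX /=.
have hV : h ^+ k.+1 / h ^+ k.+1 = 1 by apply: divrr; apply: rpredX.
have := actM v (h ^+ k.+1) (h ^- k.+1); by rewrite hV act1 => <-.
Qed.

End RightModule.

(** * The principal series representation *)

Section PrincipalSeries.
Variables (n : nat) (F : fieldType) (phi : {rmorphism laurent -> F}).
Variable x : 'I_n.+1 -> F.

Local Notation P := {perm 'I_n.+1}.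
Local Notation V := {ffun P -> F^o}.
Local Notation q := (phi laurent_q).

(** The common shape of all operators below: a diagonal part and a part coupling v to s * v. Since
    (s * v) i = v (s i), a transposition s exchanges two positions of v. *)
Definition mix (a b : P -> F) (s : P) (f : V) : V :=
  [ffun v : P => (a v * (f v : F) + b v * (f (s * v)%g : F) : F^o)].

Lemma mix_linear a b s : linear (mix a b s).
Proof.
move=> c f h; apply/ffunP => v; rewrite !ffunE /GRing.scale /=; ring.
Qed.

HB.instance Definition _ a b s :=
  GRing.isLinear.Build F V V *:%R (mix a b s) (mix_linear a b s).

(* Transposes of the Demazure-Lusztig operators, because functions on S_n are used
   as row vectors: the off-diagonal coefficient [dl_b i j v] is the usual one at the
   permutation [tperm i j * v]. *)
Definition dl_a (i j : 'I_n.+1) (v : P) : F := (q - 1) * x (v j) / (x (v j) - x (v i)).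
Definition dl_b (i j : 'I_n.+1) (v : P) : F :=
  (q * x (v i) - x (v j)) / (x (v i) - x (v j)).
Definition dl i j : V -> V := mix (dl_a i j) (dl_b i j) (tperm i j).
(** The inverse dictated by the quadratic relation, q^-1 ([dl] - (q - 1)). *)
Definition dlV i j : V -> V :=
  mix (fun v => q^-1 * (dl_a i j v - (q - 1))) (fun v => q^-1 * dl_b i j v) (tperm i j).

Hypothesis x_inj : injective x.
Hypothesis x_neq0 : forall i, x i != 0.
Hypothesis q_neq0 : q != 0.

Lemma xB_neq0 (v : P) i j : i != j -> x (v i) - x (v j) != 0.
Proof. by rewrite subr_eq0 (inj_eq x_inj) (inj_eq perm_inj). Qed.

Lemma dl_sqr i j f : i != j -> dl i j (dl i j f) = (q - 1) *: dl i j f + q *: f.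
Proof.
move=> ij; apply/ffunP => v; rewrite !ffunE /dl_a /dl_b !permM tpermL tpermR.
rewrite mulgA tperm2 mul1g /GRing.scale /=.
have h1 := xB_neq0 v ij; have h2 : x (v j) - x (v i) != 0 by rewrite xB_neq0 1?eq_sym.
by field; rewrite h1 h2.
Qed.

Lemma dlK i j f : i != j -> dlV i j (dl i j f) = f.
Proof.
move=> ij; apply/ffunP => v; rewrite !ffunE /dl_a /dl_b !permM tpermL tpermR.
rewrite mulgA tperm2 mul1g.
have h1 := xB_neq0 v ij; have h2 : x (v j) - x (v i) != 0 by rewrite xB_neq0 1?eq_sym.
by field; rewrite h1 h2 q_neq0.
Qed.

Lemma dlVK i j f : i != j -> dl i j (dlV i j f) = f.
Proof.
move=> ij; apply/ffunP => v; rewrite !ffunE /dl_a /dl_b !permM tpermL tpermR.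
rewrite mulgA tperm2 mul1g.
have h1 := xB_neq0 v ij; have h2 : x (v j) - x (v i) != 0 by rewrite xB_neq0 1?eq_sym.
by field; rewrite h1 h2 q_neq0.
Qed.

Lemma dl_far i j k l f : uniq [:: i; j; k; l] -> dl k l (dl i j f) = dl i j (dl k l f).
Proof.
rewrite /= !inE !negb_or -!andbA => /and5P[ij ik il jk /and3P[jl kl _]].
apply/ffunP => v; rewrite !ffunE /dl_a /dl_b !permM.
rewrite !tpermD // 1?eq_sym //.
have c : (tperm k l * tperm i j = tperm i j * tperm k l)%g.
  by rewrite conjgC tpermJ !tpermD // 1?eq_sym.
rewrite !mulgA c; ring.
Qed.

Lemma dl_braid i j k f : uniq [:: i; j; k] ->
  dl i j (dl j k (dl i j f)) = dl j k (dl i j (dl j k f)).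
Proof.
rewrite /= !inE !negb_or -!andbA => /and4P[ij ik jk _].
apply/ffunP => v; rewrite !ffunE /dl_a /dl_b !permM.
have ji : j != i by rewrite eq_sym.
have ki : k != i by rewrite eq_sym.
have kj : k != j by rewrite eq_sym.
rewrite !(tpermL, tpermR, tpermD ik jk, tpermD ji ki).
(* The braid relation of S_n makes both sides evaluate f at the same points; what remains is an
   identity of rational functions in three values of [x]. *)
have c : (tperm i j * (tperm j k * tperm i j) = tperm j k * (tperm i j * tperm j k))%g.
  rewrite (conjgC (tperm j k)) (conjgC (tperm i j) (tperm j k)) !tpermJ.
  by rewrite tpermR tpermL !tpermD // !mulgA !tperm2.
have hij := xB_neq0 v ij; have hji := xB_neq0 v ji.
have hik := xB_neq0 v ik; have hki := xB_neq0 v ki.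
have hjk := xB_neq0 v jk; have hkj := xB_neq0 v kj.
rewrite !mulgA in c *; rewrite c !tperm2 !mul1g.
move: (x (v i)) (x (v j)) (x (v k)) hij hji hik hki hjk hkj => a b d *.
by field; do ![apply/andP; split].
Qed.

(** The parameter [e] is the identity for t and inversion for t^-1. *)
Definition dlt (e : F -> F) : V -> V := mix (fun v => e (x (v ord0))) (fun=> 0) 1%g.

Lemma dl_dlt i j e f : i != ord0 -> j != ord0 -> dl i j (dlt e f) = dlt e (dl i j f).
Proof.
move=> i0 j0; apply/ffunP => v; rewrite !ffunE /dl_a /dl_b !permM !perm1 !mul1g.
by rewrite tpermD //; ring.
Qed.

(** This is g_(i+1) t_i g_(i+1) = t_(i+1) on diagonal operators. It serves for the relation between
    t and g_1 and, with c = q^i, for the diagonal action of every t_i. *)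
Lemma dl_x_dl i j c f : i != j ->
  dl i j [ffun v : P => c * x (v i) * (dl i j f v : F) : F^o] =
  [ffun v : P => q * c * x (v j) * (f v : F) : F^o].
Proof.
move=> ij; apply/ffunP => v; rewrite !ffunE /dl_a /dl_b !permM tpermL tpermR.
rewrite !mulgA tperm2 mul1g.
have h1 := xB_neq0 v ij; have h2 : x (v j) - x (v i) != 0 by rewrite xB_neq0 1?eq_sym.
by field; rewrite h1 h2.
Qed.

Lemma dlt_idE f : dlt id f = [ffun v : P => 1 * x (v ord0) * (f v : F) : F^o].
Proof. by apply/ffunP => v; rewrite !ffunE mul0r addr0 mul1r. Qed.

Definition ps_letter (l : braidB_gen n.+1 * bool) : V -> V :=
  let i := inord l.1.-1 in
  if l.1 == ord0 then dlt (fun y => if l.2 then y^-1 else y)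
  else if l.2 then dlV i l.1 else dl i l.1.

Lemma ps_letter_linear l : linear (ps_letter l).
Proof.
by rewrite /ps_letter; case: ifP => _; last case: ifP => _; apply: mix_linear.
Qed.

HB.instance Definition _ l :=
  GRing.isLinear.Build F V V *:%R (ps_letter l) (ps_letter_linear l).

Lemma ps_letterK k b f : ps_letter (k, ~~ b) (ps_letter (k, b) f) = f.
Proof.
rewrite /ps_letter /=; case: ifP => k0.
  apply/ffunP => v; rewrite !ffunE !mul0r !addr0 mulrA.
  by case: b; rewrite /= ?mulfV ?mulVf ?mul1r.
have ik : inord k.-1 != k.
  rewrite -val_eqE /= inordK; last exact: leq_ltn_trans (leq_pred k) (ltn_ord k).
  by case: k k0 => -[|m] hm; rewrite -val_eqE //= => _; rewrite ltn_eqF.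
by case: b => /=; [apply: dlVK|apply: dlK].
Qed.

Lemma ps_letter_t f : ps_letter (letter n.+1 0) f = dlt id f.
Proof. by rewrite /ps_letter /= -val_eqE /= inordK. Qed.

Lemma ps_letter_g i f : (0 < i <= n)%N ->
  ps_letter (letter n.+1 i) f = dl (inord i.-1) (inord i) f.
Proof. by move=> hi; rewrite /ps_letter /= -val_eqE /= inordK ?gtn_eqF //; lia. Qed.

Lemma inord_neq i j : (i <= n)%N -> (j <= n)%N -> i != j ->
  inord i != inord j :> 'I_n.+1.
Proof. by move=> hi hj ij; rewrite -val_eqE /= !inordK. Qed.

Lemma ps_rel l r : @braidB_rel n.+1 l r ->
  forall f, act_word ps_letter f l = act_word ps_letter f r.
Proof.
case=> [n1|i hi|i j hi hj hij|i i0 hi] f; rewrite /act_word /=.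
- rewrite !ps_letter_t !ps_letter_g //.
  have e0 : ord0 = inord 0 :> 'I_n.+1 by apply/val_inj; rewrite /= inordK.
  have n0 : inord 0 != inord 1 :> 'I_n.+1 by apply: inord_neq; lia.
  (* Both words act diagonally, multiplying the value at v by q x_(v 0) x_(v 1). *)
  rewrite (dlt_idE (dl _ _ f)) (dlt_idE f) e0 !dl_x_dl //.
  have := dl_x_dl 1 (dlt id f) n0; rewrite -e0 -!dlt_idE => ->.
  by apply/ffunP => v; rewrite !ffunE mul1g; ring.
- rewrite !ps_letter_t !ps_letter_g; try lia.
  by rewrite dl_dlt //; rewrite -val_eqE /= inordK; lia.
- rewrite !ps_letter_g // dl_far //.
  by rewrite !cons_uniq !inE !negb_or !inord_neq //; lia.
- rewrite !ps_letter_g; try lia; apply: dl_braid.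
  by rewrite !cons_uniq !inE !negb_or !inord_neq //; lia.
Qed.

Lemma ps_quad i : (0 < i <= n)%N -> forall f,
  ps_letter (letter n.+1 i) (ps_letter (letter n.+1 i) f) =
  (q - 1) *: ps_letter (letter n.+1 i) f + q *: f.
Proof. by move=> hi f; rewrite !ps_letter_g // dl_sqr // inord_neq //; lia. Qed.

Local Notation ps_act := (act phi ps_letter).
Local Notation g := (@hecke_g n.+1).

Lemma ps_actD f h k : ps_act (h + k) f = ps_act h f + ps_act k f.
Proof. exact: (actD ps_letterK ps_rel ps_quad). Qed.

Lemma ps_actM f h k : ps_act (h * k) f = ps_act k (ps_act h f).
Proof. exact: (actM ps_letterK ps_rel ps_quad). Qed.

Lemma ps_act1 f : ps_act 1 f = f.
Proof. exact: (act1 ps_letterK ps_rel ps_quad). Qed.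

Lemma ps_actZ f a h : ps_act (a *: h) f = phi a *: ps_act h f.
Proof. exact: (actZ ps_letterK ps_rel ps_quad). Qed.

Lemma ps_act_g i f : (0 < i <= n)%N -> ps_act (g i) f = dl (inord i.-1) (inord i) f.
Proof. by move=> hi; rewrite -ps_letter_g //; apply: (act_g ps_letterK ps_rel ps_quad). Qed.

Lemma ps_act_ti i f : (i <= n)%N ->
  ps_act (hecke_ti n.+1 i) f = [ffun v : P => q ^+ i * x (v (inord i)) * (f v : F) : F^o].
Proof.
elim: i f => [|i ih] f hi.
  rewrite hecke_ti0 (act_g ps_letterK ps_rel ps_quad) /= ps_letter_t dlt_idE.
  by rewrite (_ : inord 0 = ord0) //; apply/val_inj; rewrite /= inordK.
rewrite hecke_tiS 2!ps_actM !ps_act_g // ih 1?ltnW // dl_x_dl ?exprS //.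
by apply: inord_neq; lia.
Qed.

(** * Triangularity of the action of the basic elements *)

(** Support in the parabolic subgroup of the permutations of 0, ..., m. *)
Definition fixes_above (m : nat) (f : V) := forall v : P, (f v : F) != 0 ->
  forall j : 'I_n.+1, (m < j)%N -> v j = j.

Lemma supp_out m f (v : P) (j : 'I_n.+1) : fixes_above m f -> (m < j)%N -> v j != j -> f v = 0.
Proof.
by move=> sf mj; apply: contraNeq => fv; apply/eqP/(sf v fv).
Qed.

Lemma supp_sum m (I : Type) (s : seq I) (Q : pred I) (C : I -> F) (f : I -> V) :
  (forall i, fixes_above m (f i)) -> fixes_above m (\sum_(i <- s | Q i) C i *: f i).
Proof.
move=> sf v + j mj; apply: contra_neq_eq => vj; rewrite sum_ffunE big1 // => i _.
by rewrite ffunE (supp_out (sf i) mj vj) scaler0.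
Qed.

Lemma supp_dl m i f : (i < m)%N -> (m <= n)%N -> fixes_above m f ->
  fixes_above m (dl (inord i) (inord i.+1) f).
Proof.
move=> im mn sf v + j mj; apply: contra_neq_eq => vj; rewrite ffunE.
rewrite (supp_out sf mj vj) (supp_out (j := j) sf) //; first by rewrite !mulr0 addr0.
by rewrite permM tpermD // -val_eqE /= inordK; lia.
Qed.

Lemma supp_leq m m' f : (m <= m')%N -> fixes_above m f -> fixes_above m' f.
Proof. by move=> mm' sf v fv j mj; apply: sf => //; apply: leq_ltn_trans mj. Qed.

Lemma supp_run m l f : (m < n)%N -> (l <= m.+1)%N -> fixes_above m f ->
  fixes_above m.+1 (ps_act (run g m.+1 l) f).
Proof.
move=> mn + sf; elim: l => [|l ih] lm.
  by rewrite run0 ps_act1; apply: supp_leq sf.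
rewrite runS ps_actM ps_act_g; last by lia.
rewrite [X in inord X](_ : _ = (m - l)%N); last by lia.
rewrite (_ : m.+1 - l = (m - l).+1)%N; last by lia.
by apply: supp_dl; [lia|lia|apply: ih; lia].
Qed.

(** The l generators of the run exchange only positions m+1-l and above. Position k lies below them,
    so m+1 is at position k in every permutation at which f is evaluated, and f vanishes there. *)
Lemma run_vanish m l f (v : P) k : (m < n)%N -> fixes_above m f ->
  (k + l < m.+1)%N -> v (inord k) = inord m.+1 -> (ps_act (run g m.+1 l) f) v = 0.
Proof.
move=> mn sf; elim: l v => [|l ih] v klm vk.
  rewrite run0 ps_act1; apply: (supp_out (j := inord m.+1) sf).
    by rewrite inordK //; lia.
  by rewrite -{2}vk (inj_eq perm_inj) inord_neq //; lia.
rewrite runS ps_actM ps_act_g; last by lia.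
rewrite ffunE !ih ?mulr0 ?addr0 //; try lia.
by rewrite permM tpermD // inord_neq //; lia.
Qed.

Hypothesis qx_neq : forall i j, i != j -> q * x i - x j != 0.

(* Acting with [g_(m+1) ... g_(m+2-l)] can move the point m+1 down from its place
   to position m+1-l, no further, and only through the leading term. *)
Lemma run_lead m l (w : P) : (m < n)%N -> (l <= m.+1)%N ->
  w (inord m.+1) = inord m.+1 ->
  exists v : P, v (inord (m.+1 - l)) = inord m.+1 /\
  exists2 c : F, c != 0 &
    forall f, fixes_above m f -> (ps_act (run g m.+1 l) f) v = c * (f w : F).
Proof.
move=> mn + wm; elim: l => [|l ih] lm.
  exists w; split; first by rewrite subn0.
  by exists 1 => [|f _]; rewrite ?oner_neq0 // run0 ps_act1 mul1r.
have [|v0 [v0l [c0 c0n0 hv0]]] := ih; first by lia.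
have e : ((m.+1 - l).-1 = m.+1 - l.+1)%N by lia.
pose i : 'I_n.+1 := inord (m.+1 - l.+1); pose j : 'I_n.+1 := inord (m.+1 - l).
have ij : i != j by apply: inord_neq; lia.
(* The last generator moves m+1 one position further down. Its diagonal term vanishes by
   [run_vanish], and its off-diagonal coefficient is nonzero by [qx_neq]. *)
exists (tperm i j * v0)%g; split; first by rewrite permM tpermL.
exists (dl_b i j (tperm i j * v0)%g * c0).
  rewrite mulf_neq0 // /dl_b mulf_neq0 ?invr_neq0 ?xB_neq0 //.
  by rewrite qx_neq // (inj_eq perm_inj).
move=> f sf; rewrite runS ps_actM ps_act_g; last by lia.
rewrite e -/i -/j ffunE (run_vanish (k := (m.+1 - l.+1)%N)) //; first last.
- by rewrite -/i permM tpermL.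
- by lia.
by rewrite mulr0 add0r mulgA tperm2 mul1g hv0 // mulrA.
Qed.

Definition delta1 : V := [ffun v : P => (v == 1%g)%:R : F^o].

Lemma supp_gbas m rho : (m <= n)%N -> (forall i, rho i <= i)%N ->
  fixes_above m (ps_act (gbas g m rho) delta1).
Proof.
move=> + hrho; elim: m => [|m ih] mn.
  rewrite /gbas big_geq // ps_act1 => v; rewrite ffunE.
  by case: (v =P 1%g) => [->|]; rewrite ?eqxx // => _ j _; rewrite perm1.
rewrite /gbas big_nat_recr //= ps_actM; apply: supp_run => //.
by apply: ih; lia.
Qed.

(** Equality on the indices that [gbas] reads. *)
Definition agree m (rho rho' : nat -> nat) := all (fun i => rho i == rho' i) (iota 1 m).

(** Independence for a family with repetitions: the coefficients of each single basic element add up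
    to zero. Elements of [Sigma2] sharing a basic element are thereby kept together. *)
Lemma gbas_indep (I : Type) (rho : I -> nat -> nat) (C : I -> F) m (s : seq I) :
  (m <= n)%N -> (forall i k, rho i k <= k)%N ->
  \sum_(i <- s) C i *: ps_act (gbas g m (rho i)) delta1 = 0 ->
  forall j, \sum_(i <- s | agree m (rho i) (rho j)) C i = 0.
Proof.
move=> + hrho; elim: m s => [|m ih] s mn.
  move=> /ffunP/(_ 1%g); rewrite sum_ffunE !ffunE => s0 j; rewrite -[RHS]s0.
  apply: eq_bigr => i _; rewrite /gbas big_geq // ps_act1 !ffunE eqxx.
  by rewrite /GRing.scale /= mulr1.
move=> s0 j.
(* Terms are grouped by the length of the last run; once every group vanishes, the induction
   hypothesis applies to the group of [rho j]. *)
pose f l : V := \sum_(i <- s | rho i m.+1 == l) C i *: ps_act (gbas g m (rho i)) delta1.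
have sf l : fixes_above m (f l) by apply: supp_sum => i; apply: supp_gbas => //; lia.
have fsum : \sum_(l < m.+2) ps_act (run g m.+1 l) (f l) = 0.
  rewrite -[RHS]s0 [RHS](partition_big (fun i => inord (rho i m.+1) : 'I_m.+2) predT) //=.
  apply: eq_bigr => l _; rewrite linear_sum /=; apply: eq_big => i.
    by rewrite -val_eqE /= inordK // ltnS.
  move=> /eqP <-; rewrite linearZ /= -ps_actM; congr (_ *: ps_act _ _).
  by rewrite /gbas [in RHS]big_nat_recr.
(* Descending induction on [l]: at the point [v] of [run_lead], the summands of
   smaller index vanish by [run_vanish]. *)
have f0 d l : (l <= m.+1)%N -> (m.+1 - l < d)%N -> f l = 0.
  elim: d l => [|d ihd] l lm ld; first by rewrite ltn0 in ld.
  apply/ffunP => w; rewrite [RHS]ffunE.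
  have [wm|wm] := eqVneq (w (inord m.+1)) (inord m.+1); last first.
    by rewrite (supp_out (sf l) _ wm) // inordK.
  have [v [vl [c c0 hv]]] := run_lead mn lm wm.
  have lm2 : (l < m.+2)%N by [].
  have /ffunP/(_ v) := fsum; rewrite sum_ffunE ffunE (bigD1 (Ordinal lm2)) //= hv //.
  rewrite big1 => [|l' /negPf]; first by move/eqP; rewrite addr0 mulf_eq0 (negPf c0) => /eqP.
  rewrite -val_eqE /= => ll'; have := ltn_ord l' => hl'.
  have [ltl|gel] := ltnP l l'; first by rewrite (ihd l') ?linear0 ?ffunE //; lia.
  by apply: run_vanish vl => //; lia.
have : f (rho j m.+1) = 0 by apply: (f0 m.+2) => //; lia.
rewrite /f -big_filter => /ih -/(_ (ltnW mn) j); rewrite big_filter_cond => s1.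
rewrite -[RHS]s1.
have e : iota 1 m.+1 = rcons (iota 1 m) m.+1 by rewrite -{1}(addn1 m) iotaD cats1.
by apply: eq_bigl => i; rewrite /agree e all_rcons.
Qed.

Lemma ps_tmon lam m : (m <= n.+1)%N -> ps_act (tmon (hecke_ti n.+1) m lam) delta1 =
  (\prod_(0 <= i < m) (q ^+ i * x (inord i)) ^ lam i) *: delta1.
Proof.
elim: m => [|m ih] mn; first by rewrite /tmon !big_geq // ps_act1 scale1r.
rewrite /tmon !big_nat_recr //= ps_actM ih 1?ltnW // linearZ /= -scalerA.
congr (_ *: _); apply: (act_exprz ps_letterK ps_rel ps_quad).
- exact: hecke_ti_unit.
- by rewrite mulf_neq0 // expf_neq0.
rewrite ps_act_ti //; apply/ffunP => v; rewrite !ffunE.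
by case: eqP => [->|]; rewrite ?perm1 ?mulr0 ?scaler0.
Qed.

(** [delta1] is a common eigenvector of the t_i, with eigenvalues q^i x_i, so each monomial
    contributes a scalar and [gbas_indep] applies. *)
Lemma bernstein_indep (I : Type) (s : seq I) (lam : I -> nat -> int)
    (rho : I -> nat -> nat) (c : I -> laurent) :
  (forall i k, rho i k <= k)%N ->
  \sum_(i <- s) c i *: (tmon (hecke_ti n.+1) n.+1 (lam i) * gbas g n (rho i)) = 0 ->
  forall j, \sum_(i <- s | agree n (rho i) (rho j))
    phi (c i) * \prod_(0 <= k < n.+1) (q ^+ k * x (inord k)) ^ lam i k = 0.
Proof.
move=> hrho s0 j; apply: (gbas_indep (leqnn n) hrho _ j).
transitivity (ps_act 0 delta1); last first.
  by apply: (addrI (ps_act 0 delta1)); rewrite -ps_actD !addr0.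
rewrite -s0 (act_sum ps_letterK ps_rel ps_quad); apply: eq_bigr => i _.
have e := congr1 (ps_act (gbas g n (rho i))) (ps_tmon (lam i) (leqnn n.+1)).
by rewrite ps_actZ ps_actM e linearZ /= scalerA.
Qed.

End PrincipalSeries.

(** * Laurent monomials *)

Import Order.TTheory Num.Theory.

(** The lowest digit is a multiple of N of absolute value less than N, hence zero; then N is
    cancelled and the argument repeats. *)
Lemma kronecker_digits (N m : nat) (d : nat -> int) :
  (forall i, (i < m)%N -> `|d i| < N%:Z) ->
  \sum_(0 <= i < m) d i * N%:Z ^+ i = 0 -> forall i, (i < m)%N -> d i = 0.
Proof.
elim: m d => // m ih d hd; rewrite big_nat_recl // expr0 mulr1.
under eq_bigr do rewrite exprSr mulrA.
rewrite -mulr_suml => e.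
have d0 : d 0%N = 0.
  have := hd 0%N isT; move/eqP: e; rewrite addr_eq0 -mulNr => /eqP ->.
  move: (- _) => k; rewrite normrM; have [->|k0] := eqVneq k 0; first by rewrite mul0r.
  have k1 : 1 <= `|k| by lia.
  by rewrite ltNge (@ger0_norm _ N%:Z) ?ler_peMl.
move: e; rewrite d0 add0r => /eqP; rewrite mulf_eq0 => /orP[/eqP e|/eqP N0].
  case=> [//|i] im; apply: (ih (fun j => d j.+1)) im => [j jm|]; last exact: e.
  exact: hd.
by move=> i /hd; rewrite N0; lia.
Qed.

Section LaurentIndependence.
Variable K : fieldType.
Local Notation "a %:FP" := (tofrac (a%:P : {poly K})) (at level 2).
Local Notation z := (tofrac ('X : {poly K})).

Lemma tofracX_poly_neq0 : z != 0.
Proof. by rewrite tofrac_eq0 polyX_eq0. Qed.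

Lemma laurent_monomials_indep (I : eqType) (s : seq I) (Q : pred I)
    (a : I -> K) (e : I -> int) :
  uniq s -> {in [pred i in s | Q i] &, injective e} ->
  \sum_(i <- s | Q i) (a i)%:FP * z ^ e i = 0 ->
  forall i, i \in s -> Q i -> a i = 0.
Proof.
(* All e_i + M are nonnegative, so multiplying by z^M gives a polynomial, whose coefficients can be
   compared. *)
move=> us einj s0 y ys Qy; pose M := (\sum_(i <- s) `|e i|)%N.
have eM i : i \in s -> 0 <= e i + M%:Z.
  move=> si; suff : (`|e i| <= M)%N by lia.
  by rewrite /M (big_rem i) //= leq_addr.
pose p : {poly K} := \sum_(i <- s | Q i) a i *: 'X^`|e i + M%:Z|.
have p0 : p = 0.
  apply/eqP; rewrite -tofrac_eq0 -(mul0r (z ^ M%:Z)) -s0 mulr_suml raddf_sum /=.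
  apply/eqP; rewrite big_seq_cond [RHS]big_seq_cond; apply: eq_bigr => i /andP[si _].
  rewrite -mul_polyC tofracM tofracXn -mulrA -expfzDr ?tofracX_poly_neq0 //.
  by rewrite exprnP gez0_abs // eM.
have := congr1 (fun r : {poly K} => r`_`|e y + M%:Z|) p0.
rewrite coef0 coef_sum -big_filter (bigD1_seq y) ?filter_uniq ?mem_filter ?Qy //=.
rewrite coefZ coefXn eqxx mulr1.
rewrite big_seq_cond big1 ?addr0 // => i.
rewrite mem_filter => /andP[/andP[Qi si] iy].
rewrite coefZ coefXn; case: eqP => [ei|]; last by rewrite mulr0.
case/eqP: iy; apply: einj; rewrite ?inE ?si ?ys //.
by have := eM i si; have := eM y ys; lia.
Qed.

End LaurentIndependence.

Lemma laurent_q_inv : exists qi, qi * laurent_q = 1.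
Proof.
have h : (tofrac 'X)^-1 \in laurent_pred.
  by apply/asboolP; exists 1, 1%N; rewrite tofrac1 div1r expr1.
by exists (Laurent h); apply/val_inj; rewrite /= mulVf // -[tofrac _]expr1 tofracX_neq0.
Qed.

(** * Spanning and independence of Sigma2 *)

Section SparseProducts.
Variables (S : pzRingType) (T U : eqType) (d : T).
Variables (G : nat -> T -> S) (G' : nat -> U -> S).
Hypothesis Gd : forall i, G i d = 1.

(* Products over sparse sorted lists of (index, value) pairs, as in the definition of
   Sigma2, are products over all indices, [d] being the value of the absent ones. *)
Lemma prod_dense (enc : U -> T) (e : seq (nat * U)) a b :
  (forall i u, G i (enc u) = G' i u) ->
  sorted ltn [seq p.1 | p <- e] -> (forall i u, (i, u) \in e -> a <= i < b)%N ->
  exists2 f : nat -> T, forall i, f i = d \/ exists2 u, (i, u) \in e & f i = enc u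
    & \prod_(p <- e) G' p.1 p.2 = \prod_(a <= i < b) G i (f i).
Proof.
move=> encG srt rng; pose keys := [seq p.1 | p <- e].
pose f i := if i \in keys then nth d [seq enc p.2 | p <- e] (index i keys) else d.
have uk : uniq keys by apply: sorted_uniq srt; [exact: ltn_trans|exact: ltnn].
have fE p : p \in e -> f p.1 = enc p.2.
  move=> pe; rewrite /f map_f //; have pi : (index p e < size e)%N by rewrite index_mem.
  have -> : index p.1 keys = index p e.
    by rewrite -{1}(nth_index p pe) -(nth_map p p.1 fst pi) index_uniq // size_map.
  by rewrite (nth_map p) // nth_index.
exists f => [i|].
  have [/mapP[[k u] ke ->]|ik] := boolP (i \in keys); last by left; rewrite /f (negPf ik).
  by right; exists u => //; rewrite (fE _ ke).
transitivity (\prod_(i <- keys) G i (f i)).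
  by rewrite big_map; apply: eq_big_seq => p pe; rewrite fE // encG.
have -> : keys = [seq i <- index_iota a b | i \in keys].
  apply: (irr_sorted_eq ltn_trans ltnn srt).
    by apply: sorted_filter; [exact: ltn_trans|exact: iota_ltn_sorted].
  move=> i; rewrite mem_filter mem_index_iota; case: (boolP (i \in keys)) => //=.
  by move=> /mapP[[k u] ke ->]; rewrite (rng _ _ ke).
rewrite big_filter big_mkcond; apply: eq_bigr => i _; case: ifP => // ik.
by rewrite /f ik Gd.
Qed.

Lemma prod_sparse (dec : T -> U) (f : nat -> T) a b :
  (forall i v, v != d -> G' i (dec v) = G i v) ->
  exists e : seq (nat * U), [/\ sorted ltn [seq p.1 | p <- e],
    forall i u, (i, u) \in e -> [/\ (a <= i < b)%N, f i != d & u = dec (f i)]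
    & \prod_(a <= i < b) G i (f i) = \prod_(p <- e) G' p.1 p.2].
Proof.
move=> decG; exists [seq (i, dec (f i)) | i <- index_iota a b & f i != d]; split.
- rewrite -map_comp map_id; apply: sorted_filter; first exact: ltn_trans.
  exact: iota_ltn_sorted.
- move=> i u /mapP[j]; rewrite mem_filter mem_index_iota => /andP[fj hj] [-> ->].
  by split.
rewrite big_map big_filter [RHS]big_mkcond; apply: eq_bigr => i _ /=.
by case: eqP => [->|/eqP fi]; rewrite ?Gd // decG.
Qed.

End SparseProducts.

(** * Dense form of [Sigma2] and spanning *)

Section Hecke.
Variable n : nat.

Local Notation H := (hecke n.+1).
Local Notation g := (@hecke_g n.+1).
Local Notation ti := (@hecke_ti n.+1).
Local Notation bern := (bernstein n g ti).

Lemma hecke_basicP x : @hecke_basic n.+1 x <-> basic g n x.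
Proof.
split=> [[b [srt rng ->]]|[rho hrho ->]].
  (* A run with parameter r has r + 1 factors, hence [succn]; length 0 means no run. *)
  have [|f fP ->] := @prod_dense H nat nat 0%N (run g) (@hecke_run n.+1)
      (run0 g) succn b 1 n.+1 (fun _ _ => erefl) srt.
    by move=> i r /rng[/andP[-> ?] _].
  exists f => // i; have [->//|[r /rng[/andP[i0 _] ri] ->]] := fP i.
  by rewrite -(prednK i0).
have [|b [srt rng hb]] := @prod_sparse H nat nat 0%N (run g) (@hecke_run n.+1)
    (run0 g) predn rho 1 n.+1.
  by move=> i [|v].
exists b; split=> //; first by move=> i r /rng[hi hr ->]; have := hrho i; split; lia.
Qed.

Lemma Sigma2P x : @Sigma2 n.+1 x <-> bern x.
Proof.
have t0 i : ti i ^ 0%Z = 1 by exact: expr0z.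
split=> [[e [y [srt rng /hecke_basicP hy ->]]]|[lam [y [/hecke_basicP hy ->]]]].
  have [|f _ ->] := @prod_dense H int int 0 (fun i k => ti i ^ k) (fun i k => ti i ^ k)
      t0 id e 0 n.+1 (fun _ _ => erefl) srt.
    by move=> i k /rng[].
  by exists f, y.
have [//|e [srt rng he]] := @prod_sparse H int int 0 (fun i k => ti i ^ k)
    (fun i k => ti i ^ k) t0 id lam 0 n.+1.
exists e, y; split; [exact: srt| |exact: hy|exact: (congr1 ( *%R^~ y) he)].
by move=> i k /rng[hi hk ->]; split.
Qed.

Section Relations.
Variable qi : laurent.
Hypothesis qiq : qi * laurent_q = 1.

Lemma hecke_mulg i x : (0 < i <= n)%N -> lspan bern x ->
  lspan bern (g i * x) /\ lspan bern ((g i)^-1 * x).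
Proof.
move=> hi hx; split.
  exact: (mulg_bernstein qiq (hecke_class_unit _) (@hecke_g_sqr n) (@hecke_tgtg n)
    (@hecke_tg n) (@hecke_g_far n) (@hecke_g_braid n) (hecke_ti0 n) (@hecke_tiS n)).
exact: (mulgV_bernstein qiq (hecke_class_unit _) (@hecke_g_sqr n) (@hecke_tgtg n)
    (@hecke_tg n) (@hecke_g_far n) (@hecke_g_braid n) (hecke_ti0 n) (@hecke_tiS n)).
Qed.

Lemma hecke_mult k x : lspan bern x -> lspan bern (ti 0 ^ k * x).
Proof.
exact: (mul_tiz_span qiq (hecke_class_unit _) (@hecke_g_sqr n) (@hecke_tgtg n)
    (@hecke_tg n) (@hecke_g_far n) (@hecke_g_braid n) (hecke_ti0 n) (@hecke_tiS n)).
Qed.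

(** Each letter is t_0 or some g_k, or an inverse of these, and left multiplication by it preserves
    the span. *)
Lemma hecke_word_span w : lspan bern (@hecke_word n w).
Proof.
elim: w => [|[k b] w ih]; first exact: lspan_base (bernstein1 n g ti).
rewrite hecke_word_cons.
have -> : hecke_word [:: (k, b)] = (if b then (g k)^-1 else g k).
  have gk : hecke_word [:: (k, false)] = g k by rewrite -hecke_word1 /letter inord_val.
  have inv_eq (S : unitRingType) (a u : S) : u \is a GRing.unit -> a * u = 1 -> a = u^-1.
    by move=> uu au; rewrite -[a](mulrK uu) au mul1r.
  case: b; last exact: gk.
  rewrite -gk; apply: inv_eq; first exact: hecke_class_unit.
  rewrite -hecke_word_cat; congr hecke_class; apply/pres_classP.
  exact: (pres_cancel _ [::] k true [::]).
have [k0|k0] := eqVneq (k : nat) 0%N.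
  rewrite k0 hecke_g0 -hecke_ti0; case: b; last first.
    by rewrite -[ti 0]expr1z; apply: hecke_mult.
  by rewrite -exprN1; apply: hecke_mult.
have hk : (0 < k <= n)%N by have := ltn_ord k; lia.
by case: b; have [] := hecke_mulg hk ih.
Qed.

End Relations.

Lemma hecke_span (x : H) : lspan bern x.
Proof.
have [qi qiq] := laurent_q_inv.
elim/(@quotient_ind _ _ (@hecke_rel n.+1)): x => f.
elim/ga_ind: f => [|f h hf hh|a y].
- by rewrite quotient_class0; apply: lspan0.
- by rewrite quotient_classD; apply: lspanD.
have -> : quotient_class (@hecke_rel n.+1) << a *g y >> = a *: hecke_class y.
  by rewrite /hecke_class -quotient_classZ ga_scaleU mulr1.
apply: lspanZ; rewrite -[y]pres_class_repr.
exact: hecke_word_span qiq _.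
Qed.

Lemma Sigma2_generating : generating (@Sigma2 n.+1).
Proof.
apply: lspan_generating => x; elim: (hecke_span x) => [|a y z hy _ ih].
  exact: lspan0.
by apply: lspan_step ih; apply/Sigma2P.
Qed.

End Hecke.

(** * Monomials after Kronecker substitution *)

Section Weights.
Variables (L F : fieldType) (iota : {rmorphism L -> F}) (u : L) (z : F).

(** For u = q, the power of q contributed by the eigenvalues q^k x_k. *)
Definition root_weight m (lam : nat -> int) : L := \prod_(0 <= k < m) (u ^+ k) ^ lam k.

(** The exponent of z in a monomial once x_k = z^(N^k): the integer with signed base N digits
    [lam k]. *)
Definition kronecker (N m : nat) (lam : nat -> int) : int :=
  \sum_(0 <= k < m) lam k * N%:Z ^+ k.

Lemma root_weight_neq0 m lam : u != 0 -> root_weight m lam != 0.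
Proof.
move=> u0; rewrite /root_weight; elim/big_ind: _ => [|a b|k _]; first exact: oner_neq0.
  exact: mulf_neq0.
by rewrite expfz_neq0 // expf_neq0.
Qed.

Lemma prod_weights N m lam a : z != 0 ->
  iota a * \prod_(0 <= k < m) (iota u ^+ k * z ^+ (N ^ k)) ^ lam k =
  iota (a * root_weight m lam) * z ^ kronecker N m lam.
Proof.
move=> z0; rewrite rmorphM -mulrA; congr (_ * _); rewrite /root_weight rmorph_prod /kronecker.
have -> : z ^ (\sum_(0 <= k < m) lam k * N%:Z ^+ k) =
          \prod_(0 <= k < m) z ^ (lam k * N%:Z ^+ k).
  by apply: (big_morph (fun e => z ^ e)) => [e1 e2|]; rewrite ?expfzDr ?expr0z.
rewrite -big_split /=; apply: eq_bigr => k _.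
rewrite expfzMl fmorphXz rmorphXn; congr (_ * _).
by rewrite exprnP exprz_exp mulrC -natz natrX natz.
Qed.

End Weights.

(** * The specialization of the principal series *)

Section Independence.
Variable n : nat.

Local Notation K := {fraction {poly int}}.
Local Notation F := {fraction {poly K}}.

Definition constF : K -> F := @tofrac {poly K} \o polyC.
HB.instance Definition _ := GRing.RMorphism.copy constF (@tofrac {poly K} \o polyC).

Definition laurentF : laurent -> F := constF \o (val : laurent -> K).
HB.instance Definition _ :=
  GRing.RMorphism.copy laurentF (constF \o (val : laurent -> K)).

Variable N : nat.
Hypothesis N_gt1 : (1 < N)%N.

Local Notation z := (tofrac ('X : {poly K}) : F).
Definition point (i : 'I_n.+1) : F := z ^+ (N ^ i).

Lemma constF_eq0 a : (constF a == 0) = (a == 0).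
Proof. exact: fmorph_eq0. Qed.

Lemma laurentF_q_neq0 : laurentF laurent_q != 0.
Proof. by rewrite constF_eq0 -[val _]expr1 tofracX_neq0. Qed.

Lemma point_neq0 i : point i != 0.
Proof. by rewrite expf_neq0 // tofracX_poly_neq0. Qed.

(** The coefficient -1 of z^j survives. The case a = q gives [qpoint_neq], the case a = 1 gives
    [point_inj]. *)
Lemma tofracXn_neq (a : K) i j : i != j -> constF a * z ^+ i - z ^+ j != 0.
Proof.
move=> ij; rewrite /constF /= -!tofracXn -tofracM -tofracB tofrac_eq0 mul_polyC.
apply/eqP => /(congr1 (fun p : {poly K} => p`_j)) /eqP.
rewrite coefB coefZ !coefXn eqxx [j == i]eq_sym (negPf ij) mulr0 sub0r coef0.
by rewrite oppr_eq0 oner_eq0.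
Qed.

Lemma expN_neq (i j : 'I_n.+1) : i != j -> (N ^ i != N ^ j)%N.
Proof. by rewrite eqn_exp2l. Qed.

Lemma qpoint_neq i j : i != j -> laurentF laurent_q * point i - point j != 0.
Proof. by move=> ij; apply/tofracXn_neq/expN_neq. Qed.

Lemma point_inj : injective point.
Proof.
move=> i j ij; apply/eqP; apply: contraT => /expN_neq /(tofracXn_neq 1).
by rewrite rmorph1 mul1r -/(point i) -/(point j) ij subrr eqxx.
Qed.

Lemma prod_points (c : laurent) lam :
  laurentF c * \prod_(0 <= k < n.+1) (laurentF laurent_q ^+ k * point (inord k)) ^ lam k =
  constF (val c * root_weight (tofrac 'X) n.+1 lam) * z ^ kronecker N n.+1 lam.
Proof.
apply: etrans (prod_weights constF _ _ _ _ _ (tofracX_poly_neq0 K)).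
apply: (f_equal ( *%R (laurentF c))); apply: eq_big_nat => k kn.
by rewrite /point inordK.
Qed.

End Independence.

Lemma Sigma2_linear_independent n : linear_independent (@Sigma2 n.+1).
Proof.
pose g := @hecke_g n.+1; pose ti := @hecke_ti n.+1.
move=> s c us sS s0 y0 ys0.
have /choice[ix ixP] : forall x : hecke n.+1, exists p : (nat -> int) * (nat -> nat),
    (forall k, p.2 k <= k)%N /\ (x \in s -> x = tmon ti n.+1 p.1 * gbas g n p.2).
  move=> x; have [/sS/Sigma2P[lam [_ [[rho hrho ->] ->]]]|_] := boolP (x \in s).
    by exists (lam, rho).
  (* Off [s] any admissible data will do, the bound on run lengths being required everywhere. *)
  by exists (fun=> 0, fun=> 0%N).
pose lam x := (ix x).1; pose rho x := (ix x).2.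
have hrho x : forall k, (rho x k <= k)%N by have [] := ixP x.
have xE x : x \in s -> x = tmon ti n.+1 (lam x) * gbas g n (rho x) by have [] := ixP x.
pose B := (\sum_(x <- s) \sum_(0 <= k < n.+1) `|lam x k|)%N.
have lamB x k : x \in s -> (k < n.+1)%N -> (`|lam x k| <= B)%N.
  move=> xs kn; rewrite /B (big_rem x) //= (bigD1_seq k) ?iota_uniq //=.
    by rewrite -addnA leq_addr.
  by rewrite mem_index_iota.
(* Differences of two exponents are at most 2B in absolute value, hence less than N; moreover N >
   1. *)
pose N := (B + B).+2.
have N1 : (1 < N)%N by [].
have s0' : \sum_(x <- s) c x *: (tmon ti n.+1 (lam x) * gbas g n (rho x)) = 0.
  by rewrite -[RHS]s0; apply: eq_big_seq => x xs; rewrite -xE.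
have key := bernstein_indep (point_inj N1) (@point_neq0 n N) laurentF_q_neq0
  (qpoint_neq N1) hrho s0'.
have := key y0.
pose a x : {fraction {poly int}} := val (c x) * root_weight (tofrac 'X) n.+1 (lam x).
have -> : \sum_(x <- s | agree n (rho x) (rho y0)) laurentF (c x) *
      \prod_(0 <= k < n.+1) (laurentF laurent_q ^+ k * point N (inord k : 'I_n.+1)) ^ lam x k =
    \sum_(x <- s | agree n (rho x) (rho y0)) tofrac (a x)%:P *
      tofrac 'X ^ kronecker N n.+1 (lam x).
  apply: eq_bigr => x _; exact: prod_points.
move=> /(laurent_monomials_indep us) a0.
have : a y0 = 0.
  apply: a0 => //; last by apply/allP.
  (* Among elements with the basic part of [y0], equal powers of z force equal digits, that is equal
     [lam], and so equal elements. *)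
  move=> x y /andP[xs /allP xr] /andP[ys /allP yr] /eqP; rewrite -subr_eq0.
  rewrite /kronecker -sumrB; under eq_bigr do rewrite -mulrBl.
  move=> /eqP /(@kronecker_digits N n.+1 (fun k => lam x k - lam y k)) lamE.
  have {}lamE k : (k < n.+1)%N -> lam x k = lam y k.
    move=> kn; apply/eqP; rewrite -subr_eq0; apply/eqP/lamE => // j jn.
    by have := lamB x j xs jn; have := lamB y j ys jn; rewrite /N; lia.
  rewrite (xE x xs) (xE y ys).
  have -> : tmon ti n.+1 (lam x) = tmon ti n.+1 (lam y).
    by apply: eq_big_nat => k /andP[_ kn]; rewrite lamE.
  have -> // : gbas g n (rho x) = gbas g n (rho y).
  apply: eq_big_nat => k kn; congr run.
  have kI : k \in iota 1 n by rewrite mem_iota.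
  by rewrite (eqP (xr k kI)) (eqP (yr k kI)).
(* The power of q is nonzero and cancels. *)
move/eqP; rewrite mulf_eq0 (negPf (root_weight_neq0 _ _ (tofracX_neq0 1))) orbF => /eqP c0.
exact/val_inj.
Qed.

Theorem theorem1 (n : nat) (hn : (1 <= n)%N) :
  @is_basis laurent (hecke n) (@Sigma2 n).
Proof.
case: n hn => // n _; split; first exact: Sigma2_linear_independent.
exact: Sigma2_generating.
Qed.
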